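(* Let $K,N\ge1$ and $M\ge KN$ be integers and let the stacked channel $\mathbf H\in\mathbb C^{KN\times M}$ have i.i.d. zero-mean unit-variance circularly-symmetric complex Gaussian entries. Define $\beta_{\mathrm{DPC\text{-}BD}}(\mathbf H)=\lim_{P\to\infty}[\mathcal C_{\mathrm{DPC}}(\mathbf H,P)-\mathcal C_{\mathrm{BD}}(\mathbf H,P)]$ and $\bar\beta_{\mathrm{DPC\text{-}BD}}(M,K,N)=\mathbb E_{\mathbf H}[\beta_{\mathrm{DPC\text{-}BD}}(\mathbf H)]$. Then $$\bar\beta_{\mathrm{DPC\text{-}BD}}(M,K,N)=\log_2 e\sum_{k=0}^{K-1}\sum_{n=0}^{N-1}\sum_{i=kN+1}^{(K-1)N}\frac{1}{M-n-i}\quad\text{(bits/s/Hz)}.$$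
   Context: MIMO broadcast channel with $M$ transmit antennas and $K$ users with $N$ antennas each; user $k$ has channel $\mathbf H_k\in\mathbb C^{N\times M}$ and $\mathbf H$ stacks $\mathbf H_1,\dots,\mathbf H_K$; unit noise, total power $P$. $\mathcal C_{\mathrm{DPC}}(\mathbf H,P)=\max\{\log_2|\mathbf I+\sum_k\mathbf H_k^H\mathbf Q_k\mathbf H_k| : \mathbf Q_k\succeq0\ (N\times N),\ \sum_k\mathrm{tr}\mathbf Q_k\le P\}$. Block diagonalization: for each $k$ let $\mathbf V_k$ be an $M\times(M-(K-1)N)$ matrix whose orthonormal columns span the null space of the matrix stacking $\{\mathbf H_j\}_{j\ne k}$ (so $\mathbf H_j\mathbf V_k=\mathbf 0$ for $j\neq k$), and $\mathbf G_k=\mathbf H_k\mathbf V_k$. The block-diagonalization sum rate is $\mathcal C_{\mathrm{BD}}(\mathbf H,P)=\max\sum_{k=1}^K\log_2|\mathbf I+\mathbf G_k\mathbf Q_k\mathbf G_k^H|$ over positive semidefinite $\mathbf Q_k$ with $\sum_k\mathrm{tr}\mathbf Q_k\le P$. ($\mathbf H$ has full row rank with probability one.) *)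

(* Defs.v *)
From HB Require Import structures.
From mathcomp Require Import all_boot all_order all_algebra.
From mathcomp Require Import all_classical all_reals all_analysis.
From mathcomp Require Import complex.
From mathcomp Require Import zify.
Set Implicit Arguments. Unset Strict Implicit. Unset Printing Implicit Defensive.
Import Order.TTheory GRing.Theory Num.Theory numFieldNormedType.Exports.
Local Open Scope classical_set_scope.
Local Open Scope ring_scope.

Section MIMO.
Variable R : realType.
Local Notation C := R[i].

Definition hadj (m n : nat) (A : 'M[C]_(m, n)) : 'M[C]_(n, m) :=
  (map_mx (@conjc R) A)^T.

Definition psd (n : nat) (Q : 'M[C]_n) : Prop :=
  hadj Q = Q /\ forall v : 'cV[C]_n, 0 <= (hadj v *m Q *m v) ord0 ord0.

Definition log2 (x : R) : R := ln x / ln 2.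

(* log2 |A| for a Hermitian positive definite A (whose determinant is real) *)
Definition log2det (n : nat) (A : 'M[C]_n) : R := log2 (complex.Re (\det A)).

Lemma blk_idx_subproof (K N : nat) (k : 'I_K) (i : 'I_N) : (k * N + i < K * N)%N.
Proof.
have hk := ltn_ord k; have hi := ltn_ord i.
have : (k.+1 * N <= K * N)%N by rewrite leq_mul2r hk orbT.
rewrite mulSn; lia.
Qed.

Definition blk_idx (K N : nat) (k : 'I_K) (i : 'I_N) : 'I_(K * N) :=
  Ordinal (blk_idx_subproof k i).

Definition Hblk (K N M : nat) (H : 'M[C]_(K * N, M)) (k : 'I_K) : 'M[C]_(N, M) :=
  \matrix_(i < N, j < M) H (blk_idx k i) j.

Definition feasible (K n : nat) (Q : 'I_K -> 'M[C]_n) (P : R) : Prop :=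
  (forall k, psd (Q k)) /\ \sum_(k < K) complex.Re (\tr (Q k)) <= P.

Definition C_DPC (K N M : nat) (H : 'M[C]_(K * N, M)) (P : R) : R :=
  sup [set x | exists Q : 'I_K -> 'M[C]_N, feasible Q P /\
     x = log2det (1%:M + \sum_(k < K) hadj (Hblk H k) *m Q k *m Hblk H k)].

Definition BD_precoders (K N M : nat) (H : 'M[C]_(K * N, M))
    (V : 'I_K -> 'M[C]_(M, M - (K - 1) * N)) : Prop :=
  forall k : 'I_K,
    hadj (V k) *m V k = 1%:M /\
    (forall j : 'I_K, j != k -> Hblk H j *m V k = 0) /\
    (forall x : 'cV[C]_M, (forall j : 'I_K, j != k -> Hblk H j *m x = 0) ->
       exists y : 'cV[C]_(M - (K - 1) * N), x = V k *m y).

Definition C_BD (K N M : nat) (H : 'M[C]_(K * N, M)) (P : R) : R :=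
  sup [set x | exists (V : 'I_K -> 'M[C]_(M, M - (K - 1) * N))
                      (Q : 'I_K -> 'M[C]_(M - (K - 1) * N)),
     BD_precoders H V /\ feasible Q P /\
     x = \sum_(k < K) log2det (1%:M + (Hblk H k *m V k) *m Q k
                                       *m hadj (Hblk H k *m V k))].

Definition beta_DPC_BD (K N M : nat) (H : 'M[C]_(K * N, M)) : R :=
  lim ((C_DPC H P - C_BD H P) @[P --> +oo]).

(* Expectation of f(x_1,...,x_n) for x_1..x_n i.i.d. real N(0,1/2),
   density exp(-x^2)/sqrt(pi), as iterated Lebesgue integrals. *)
Fixpoint gauss_expect (n : nat) (f : seq R -> \bar R) : \bar R :=
  match n with
  | 0 => f [::]
  | n'.+1 => (\int[@lebesgue_measure R]_x
                (((Num.sqrt pi)^-1 * expR (- x ^+ 2))%:E *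
                 gauss_expect n' (fun s => f (x :: s))))%E
  end.

(* complex p x q matrix whose (i,j) entry has real / imaginary parts the
   entries 2(iq+j), 2(iq+j)+1 of s: with s i.i.d. N(0,1/2), the entries are
   i.i.d. CN(0,1) *)
Definition cmx_of_seq (p q : nat) (s : seq R) : 'M[C]_(p, q) :=
  \matrix_(i < p, j < q)
     Complex (nth 0 s (2 * (i * q + j))) (nth 0 s (2 * (i * q + j)).+1).

Definition beta_bar (K N M : nat) : \bar R :=
  gauss_expect (2 * (K * N * M))
    (fun s => (beta_DPC_BD (cmx_of_seq (K * N) M s))%:E).

End MIMO.

(* Main.v *)
(* For a channel whose relevant Gram matrices are invertible, both sum
   capacities grow like [n ln (P / n)] with [n = K N], up to constants squeezed
   by AM-GM on eigenvalues from above and equal power allocation from below.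
   Hence [ln 2 * beta] is the sum over [k] of the log Gram determinants of the
   rows outside block [k], minus [K - 1] times the log Gram determinant of all
   rows (block diagonalization sees [|G_k G_k^H|], a Schur complement).

   Appending one row [a] multiplies a Gram determinant by [a P a^H], with [P]
   the orthogonal projection onto the kernel of the previous rows. The
   coefficients of the logarithms sum to zero, so the gain of each row is a sum
   of differences [ln (a P' a^H) - ln (a P a^H)] with nested projections
   [P <= P']. By Frullani's formula such a difference is the integral over
   [t > 0] of the nonnegative [(exp (- t a P a^H) - exp (- t a P' a^H)) / t], and
   by completing the square the Gaussian mean of [exp (- t a P a^H)] is
   [1 / det (1 + t P) = (1 + t)^(- rank P)]. Tonelli, one real variable at a time,
   then gives the mean [1/r + ... + 1/(r' - 1)], where [r], [r'] are the ranks. *)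

Require Import Defs.
From HB Require Import structures.
From mathcomp Require Import all_boot all_order all_algebra.
From mathcomp Require Import all_classical all_reals all_analysis.
From mathcomp Require Import perm measurable_realfun complex ring lra zify.
Set Implicit Arguments. Unset Strict Implicit. Unset Printing Implicit Defensive.
Import Order.TTheory GRing.Theory Num.Theory numFieldNormedType.Exports.
Local Open Scope classical_set_scope.
Local Open Scope ring_scope.

(** * Iterated Gaussian means *)

(** [beta_bar] integrates a function made of [sup] and [lim], which is uncontrolled at degenerate
    channels. No measurability of it is proved: the relation [gauss_mean] tolerates null sets at
    every level, and [integral] ignores null sets even for nonmeasurable integrands. Tonelli does
    need joint measurability in the parameter [t], so the exponentials live in the stricter
    [gauss_pmean], and null sets enter when [t] is integrated out. The ranks come from counting
    rows. When row [r] is appended, [r %/ N] blocks are complete; outside each of them lie [r - N]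
    earlier rows, so the two kernels have dimensions [M - r] and [M - r + N], and the gain is a sum
    of [N] reciprocals. A block not yet begun has the same kernel on both sides and gains nothing.
    The block of the row itself does not see the row, which is why [K - 1] copies of the full Gram
    determinant balance the others. *)

Section IntegralAe.
Local Open Scope ereal_scope.
Context d (T : measurableType d) (R : realType) (mu : {measure set T -> \bar R}).

Import HBNNSimple.

Lemma ae_le_integral_ge0 (f g : T -> \bar R) :
  (forall x, 0 <= f x) -> (forall x, 0 <= g x) ->
  {ae mu, forall x, f x = g x} -> \int[mu]_x f x <= \int[mu]_x g x.
Proof.
move=> f0 g0 [N [mN N0 subN]].
rewrite ge0_integralTE//; apply: ge_ereal_sup => _ [h /= hf <-].
have mh : measurable_fun setT (fun x => (h x)%:E) by apply/measurable_EFinP.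
have -> : sintegral mu h = \int[mu]_x (h x)%:E.
  by rewrite integral_nnsfun// patch_setT.
(* Only the simple function [h] is restricted to the complement of [N]; every simple function below
   that restriction is below [g] everywhere. *)
rewrite (ge0_negligible_integral mN)//; last first.
  by move=> x _; rewrite lee_fin fun_ge0.
rewrite integral_mkcond ge0_integralTE; last first.
  by move=> x; apply: erestrict_ge0 => y _; rewrite lee_fin fun_ge0.
rewrite [leRHS]ge0_integralTE//.
apply: ereal_sup_le => _ [k /= kf <-]; exists k => //=.
move=> x; apply: (le_trans (kf x)); rewrite patchE; case: ifPn => // /[!inE].
move=> -[_ Nx]; apply: le_trans (hf x) _.
by rewrite (_ : f x = g x)//; apply: contrapT => fg; apply: Nx; exact: subN.
Qed.

(* No measurability is assumed: [integral] is a supremum over simple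
   functions, which may be multiplied by the indicator of a conegligible set. *)
Lemma ae_eq_integral_nonmeas (f g : T -> \bar R) :
  {ae mu, forall x, f x = g x} -> \int[mu]_x f x = \int[mu]_x g x.
Proof.
have main (u v : T -> \bar R) : (forall x, 0 <= u x) -> (forall x, 0 <= v x) ->
    {ae mu, forall x, u x = v x} -> \int[mu]_x u x = \int[mu]_x v x.
  move=> u0 v0 uv; apply/eqP; rewrite eq_le !ae_le_integral_ge0//.
  by apply: filterS uv => x.
move=> fg; rewrite integralE [RHS]integralE; congr (_ - _); apply: main => //.
- by apply: filterS fg => x fgx; rewrite 2!funeposE fgx.
- by apply: filterS fg => x fgx; rewrite 2!funenegE fgx.
Qed.

End IntegralAe.

Section GaussMean.
Context (R : realType).
Local Notation mu := (@lebesgue_measure R).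

#[global] Instance lebesgue_ae_filter : @Filter R (nbhs (almost_everywhere mu)) :=
  ae_filter_ringOfSetsType mu.

Definition gauss_weight (x : R) : R := (Num.sqrt pi)^-1 * expR (- x ^+ 2).

Lemma gauss_weight_gt0 x : 0 < gauss_weight x.
Proof. by rewrite mulr_gt0 ?expR_gt0// invr_gt0 sqrtr_gt0 pi_gt0. Qed.

Lemma measurable_gauss_weight : measurable_fun setT gauss_weight.
Proof. by apply: measurable_funM => //; exact: measurable_gauss_fun. Qed.

Lemma integrable_gauss_weight : mu.-integrable setT (EFin \o gauss_weight).
Proof.
have := integrableZl (D := setT) measurableT (Num.sqrt pi)^-1 (@integrableT_gauss R).
by apply: eq_integrable => // x _; rewrite /= -EFinM.
Qed.

Lemma integral_gauss_weight : (\int[mu]_x (gauss_weight x)%:E = 1)%E.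
Proof.
under eq_integral do rewrite EFinM.
rewrite integralZl//; last exact: integrableT_gauss.
rewrite integralT_gauss -EFinM mulVf// gt_eqF// sqrtr_gt0.
exact: pi_gt0.
Qed.

(** Almost everywhere in the iterated sense, one variable after another. It follows the recursion of
    [gauss_mean], so no product measure on sequences is built. *)
Fixpoint gauss_ae (n : nat) (P : seq R -> Prop) : Prop :=
  match n with
  | 0 => P [::]
  | n'.+1 => {ae mu, forall x, gauss_ae n' (fun s => P (x :: s))}
  end.

(* [f] has iterated Gaussian mean [c], every inner integral existing outside
   a null set of the outer variables. *)
Fixpoint gauss_mean (n : nat) (f : seq R -> R) (c : R) : Prop :=
  match n with
  | 0 => f [::] = c
  | n'.+1 => exists g : R -> R,
     [/\ {ae mu, forall x, gauss_mean n' (fun s => f (x :: s)) (g x)},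
         mu.-integrable setT (fun x => (gauss_weight x * g x)%:E) &
         (\int[mu]_x (gauss_weight x * g x)%:E = c%:E)%E]
  end.

Lemma gauss_ae_all n (P : seq R -> Prop) :
  (forall s, size s = n -> P s) -> gauss_ae n P.
Proof.
elim: n P => [|n IH] P h /=; first exact: h.
by apply: aeW => x; apply: IH => s sn; apply: h; rewrite /= sn.
Qed.

Lemma gauss_ae_impl n (P Q : seq R -> Prop) :
  (forall s, size s = n -> P s -> Q s) -> gauss_ae n P -> gauss_ae n Q.
Proof.
elim: n P Q => [|n IH] P Q h /=; first exact: h.
by move=> hP; apply: filterS hP => x; apply: IH => s sn; apply: h; rewrite /= sn.
Qed.

Lemma gauss_ae_cat m n (P : seq R -> Prop) :
  gauss_ae m (fun s => gauss_ae n (fun s' => P (s ++ s'))) ->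
  gauss_ae (m + n) P.
Proof.
elim: m P => [|m IH] P //=.
by move=> hP; apply: filterS hP => x; exact: IH.
Qed.

Lemma gauss_mean_ae n (f g : seq R -> R) c :
  gauss_ae n (fun s => f s = g s) -> gauss_mean n f c -> gauss_mean n g c.
Proof.
elim: n f g c => [|n IH] f g c /=; first by move=> ->.
move=> fg [h [hf hi hc]]; exists h; split=> //.
by apply: filterS2 fg hf => x; exact: IH.
Qed.

(** Tower property: [g] is the conditional mean given the first [m] variables. It allows one channel
    row to be averaged at a time. *)
Lemma gauss_mean_cat m n (f g : seq R -> R) c :
  gauss_mean m g c ->
  gauss_ae m (fun s => gauss_mean n (fun s' => f (s ++ s')) (g s)) ->
  gauss_mean (m + n) f c.
Proof.
elim: m f g c => [|m IH] f g c /=; first by move=> <-.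
move=> [h [hf hi hc]] fg; exists h; split=> //.
by apply: filterS2 hf fg => x; exact: IH.
Qed.

Lemma gauss_mean_cst n (c : R) : gauss_mean n (fun=> c) c.
Proof.
elim: n c => [|n IH] c //=; exists (fun=> c); split.
- exact: aeW.
- have := integrableZr (D := setT) measurableT c integrable_gauss_weight.
  by apply: eq_integrable.
- under eq_integral do rewrite mulrC EFinM.
  rewrite integralZl//; last exact: integrable_gauss_weight.
  by rewrite integral_gauss_weight mule1.
Qed.

Lemma gauss_meanD n (f g : seq R -> R) c d :
  gauss_mean n f c -> gauss_mean n g d ->
  gauss_mean n (fun s => f s + g s) (c + d).
Proof.
elim: n f g c d => [|n IH] f g c d /=; first by move=> -> ->.
move=> [h [hf hi hc]] [k [kg ki kd]]; exists (fun x => h x + k x); split.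
- by apply: filterS2 hf kg => x; exact: IH.
- have := integrableD (D := setT) measurableT hi ki.
  by apply: eq_integrable => // x _; rewrite /= -EFinD mulrDr.
- under eq_integral do rewrite mulrDr EFinD.
  by rewrite integralD// hc kd.
Qed.

Lemma gauss_mean_sum n I (r : seq I) (P : pred I) (f : I -> seq R -> R) c :
  (forall i, P i -> gauss_mean n (f i) (c i)) ->
  gauss_mean n (fun s => \sum_(i <- r | P i) f i s) (\sum_(i <- r | P i) c i).
Proof.
move=> h; elim: r => [|i r IH].
  under eq_fun do rewrite big_nil; rewrite big_nil; exact: gauss_mean_cst.
under eq_fun do rewrite big_cons; rewrite big_cons.
by case: ifPn => // Pi; apply: gauss_meanD IH; exact: h.
Qed.

Lemma gauss_meanZ n k (f : seq R -> R) c :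
  gauss_mean n f c -> gauss_mean n (fun s => k * f s) (k * c).
Proof.
elim: n f c => [|n IH] f c /=; first by move=> ->.
move=> [h [hf hi hc]]; exists (fun x => k * h x); split.
- by apply: filterS hf => x; exact: IH.
- have := integrableZl (D := setT) measurableT k hi.
  by apply: eq_integrable => // x _; rewrite /= -EFinM mulrCA.
- under eq_integral do rewrite mulrCA EFinM.
  by rewrite integralZl// hc.
Qed.

(** The inner [gauss_expect] is known for almost every [x] only and may be anything elsewhere, hence
    the appeal to [ae_eq_integral_nonmeas]. *)
Lemma gauss_mean_expect n (f : seq R -> R) c :
  gauss_mean n f c -> gauss_expect n (fun s => (f s)%:E) = c%:E.
Proof.
elim: n f c => [|n IH] f c /=; first by move=> ->.
move=> [h [hf hi <-]]; apply: ae_eq_integral_nonmeas.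
by apply: filterS hf => x /IH ->.
Qed.

(* Same as [gauss_mean] for a function of a parameter [t], without exceptional
   sets but with joint measurability in [t] at each level, as Tonelli needs. *)
Fixpoint gauss_pmean (n : nat) (f : R -> seq R -> R) (c : R -> R) : Prop :=
  match n with
  | 0 => forall t, f t [::] = c t
  | n'.+1 => exists g : R -> R -> R,
     [/\ forall x, gauss_pmean n' (fun t s => f t (x :: s)) (g ^~ x),
         measurable_fun setT (fun p : R * R => g p.1 p.2),
         forall t, mu.-integrable setT (fun x => (gauss_weight x * g t x)%:E) &
         forall t, (\int[mu]_x (gauss_weight x * g t x)%:E = (c t)%:E)%E]
  end.

Lemma gauss_pmean_cat m n (f g : R -> seq R -> R) c :
  gauss_pmean m g c ->
  (forall s, size s = m ->
     gauss_pmean n (fun t s' => f t (s ++ s')) (fun t => g t s)) ->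
  gauss_pmean (m + n) f c.
Proof.
elim: m f g c => [|m IH] f g c /=.
  by move=> /funext <- /(_ [::] erefl).
move=> [h [hf hm hi hc]] fg; exists h; split=> // x.
by apply: IH (hf x) _ => s sm; apply: (fg (x :: s)); rewrite /= sm.
Qed.

Lemma gauss_pmeanB n (f g : R -> seq R -> R) c d :
  gauss_pmean n f c -> gauss_pmean n g d ->
  gauss_pmean n (fun t s => f t s - g t s) (fun t => c t - d t).
Proof.
elim: n f g c d => [|n IH] f g c d /=; first by move=> h k t; rewrite h k.
move=> [h [hf hm hi hc]] [k [kg km ki kd]].
exists (fun t x => h t x - k t x); split.
- by move=> x; exact: IH.
- exact: measurable_funB.
- move=> t; have := integrableB (D := setT) measurableT (hi t) (ki t).
  by apply: eq_integrable => // x _; rewrite /= -EFinB mulrBr.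
- move=> t; under eq_integral do rewrite mulrBr EFinB.
  by rewrite integralB// hc kd.
Qed.

Lemma gauss_pmeanZ n (k : R -> R) (f : R -> seq R -> R) c : measurable_fun setT k ->
  gauss_pmean n f c ->
  gauss_pmean n (fun t s => k t * f t s) (fun t => k t * c t).
Proof.
move=> km; elim: n f c => [|n IH] f c /=; first by move=> h t; rewrite h.
move=> [h [hf hm hi hc]]; exists (fun t x => k t * h t x); split.
- by move=> x; exact: IH.
- by apply: measurable_funM => //; apply: measurableT_comp.
- move=> t; have := integrableZl (D := setT) measurableT (k t) (hi t).
  by apply: eq_integrable => // x _; rewrite /= -EFinM mulrCA.
- move=> t; under eq_integral do rewrite mulrCA EFinM.
  by rewrite integralZl// hc.
Qed.

Lemma gauss_pmean_ge0 n (f : R -> seq R -> R) c :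
  (forall t s, size s = n -> 0 <= f t s) -> gauss_pmean n f c ->
  forall t, 0 <= c t.
Proof.
elim: n f c => [|n IH] f c f0 /=; first by move=> h t; rewrite -h f0.
move=> [h [hf hm hi hc]] t; rewrite -lee_fin -hc.
apply: integral_ge0 => x _; rewrite lee_fin mulr_ge0 ?(ltW (gauss_weight_gt0 _))//.
by apply: (IH _ _ _ (hf x) t) => u s sn; apply: f0; rewrite /= sn.
Qed.

(** Tonelli moves the integral over [t] inside the outermost Gaussian integral; the induction
    hypothesis then moves it further in. It applies to those [x] whose slice in [t] is integrable,
    which is almost all of them. *)
Lemma gauss_pmean_mean n (f : R -> seq R -> R) c :
  (forall t s, size s = n -> 0 <= f t s) -> gauss_pmean n f c ->
  mu.-integrable setT (EFin \o c) ->
  gauss_mean n (fun s => \int[mu]_t f t s) (\int[mu]_t c t).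
Proof.
elim: n f c => [|n IH] f c f0 /=; first by move=> /funext ->.
move=> [g [gf gm gi gc]] ci.
have g0 t x : 0 <= g t x.
  by apply: (gauss_pmean_ge0 _ (gf x) t) => u s sn; apply: f0; rewrite /= sn.
have w0 x := gauss_weight_gt0 x.
pose F (p : R * R) := (gauss_weight p.2 * g p.1 p.2)%:E.
have mF : measurable_fun setT F.
  apply/measurable_EFinP; apply: measurable_funM => //.
  by apply: measurableT_comp => //; exact: measurable_gauss_weight.
have F0 p : (0 <= F p)%E by rewrite lee_fin mulr_ge0// ltW.
have intc : (\int[mu]_t (c t)%:E = (\int[mu]_t c t)%:E)%E.
  by rewrite fineK//; exact: integrable_fin_num.
have IF : (\int[mu]_x \int[mu]_t F (t, x) = (\int[mu]_t c t)%:E)%E.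
  rewrite -fubini_tonelli//= -intc.
  by apply: eq_integral => t _; exact: gc.
(* The iterated integral of the nonnegative [F] is the finite integral of [c]; integrability on the
   plane then gives integrable slices. *)
have iF : (mu \x mu)%E.-integrable setT F.
  apply/integrable21ltyP => //.
  rewrite [ltLHS](_ : _ = (\int[mu]_t c t)%:E) ?ltry// -IF.
  by apply: eq_integral => x _; apply: eq_integral => t _; rewrite gee0_abs.
have GE x : (\int[mu]_t F (t, x) =
    (gauss_weight x)%:E * \int[mu]_t (g t x)%:E)%E.
  have mg : measurable_fun setT (fun t => (g t x)%:E).
    apply/measurable_EFinP.
    exact: (measurableT_comp gm (pair2_measurable x)).
  rewrite -ge0_integralZl ?lee_fin ?ltW// => t _; exact: g0.
have aeg : {ae mu, forall x, mu.-integrable setT (fun t => (g t x)%:E)}.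
  have := ae_integrable2 iF; apply: filterS => y h.
  have := integrableZl (D := setT) measurableT (gauss_weight y)^-1 h.
  by apply: eq_integrable => // t _; rewrite /F /= -EFinM mulKf// gt_eqF.
(* This holds for every [x], since [fine] sends an infinite integral to 0 on both sides;
   measurability in [x] can thus be read off without an exceptional set. *)
have fineG x : ((gauss_weight x * \int[mu]_t g t x) =
    fine (\int[mu]_t F (t, x)))%R.
  rewrite GE /Rintegral; case: (\int[mu]_t (g t x)%:E)%E => [r||] //=.
    by rewrite mulr0 gt0_muley ?lte_fin.
  by rewrite mulr0 gt0_muleNy ?lte_fin.
have aeG : {ae mu, forall x, (gauss_weight x * \int[mu]_t g t x)%:E =
    (\int[mu]_t F (t, x))%E}.
  apply: filterS aeg => x gx; rewrite fineG fineK// GE fin_numM//.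
  exact: integrable_fin_num.
exists (fun x => \int[mu]_t g t x); split.
- apply: filterS aeg => x; apply: IH => //.
  by move=> t s sn; apply: f0; rewrite /= sn.
- apply/integrableP; split.
    apply/measurable_EFinP; under eq_fun do rewrite fineG.
    apply: (measurableT_comp (@fine_measurable R setT measurableT)) => //.
    exact: (measurable_fun_fubini_tonelli_G (m1 := mu) F mF F0).
  rewrite [ltLHS](_ : _ = (\int[mu]_t c t)%:E) ?ltry// -IF.
  apply: ae_eq_integral_nonmeas; apply: filterS aeG => x <-; rewrite gee0_abs// lee_fin mulr_ge0//.
    exact: ltW.
  by apply: Rintegral_ge0.
- by rewrite -IF; exact: ae_eq_integral_nonmeas aeG.
Qed.

End GaussMean.

(** * Completing the square in one complex Gaussian variable *)

Section GaussianIntegral.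
Context (R : realType).
Local Notation mu := (@lebesgue_measure R).

Lemma measurable_fun_inv_pos d (T : measurableType d) (f : T -> R) :
  (forall x, 0 < f x) -> measurable_fun setT f ->
  measurable_fun setT (fun x => (f x)^-1).
Proof.
move=> f0 mf; rewrite (_ : (fun x => _) = (fun x => expR (- ln (f x)))).
  apply: measurableT_comp => //; apply: measurableT_comp => //.
  exact: measurableT_comp.
by apply/funext => x; rewrite expRN lnK// posrE.
Qed.

Lemma measurable_fun_sqrt_pos d (T : measurableType d) (f : T -> R) :
  (forall x, 0 < f x) -> measurable_fun setT f ->
  measurable_fun setT (fun x => Num.sqrt (f x)).
Proof.
move=> f0 mf.
rewrite (_ : (fun x => _) = (fun x => expR (2^-1 * ln (f x)))).
  apply: measurableT_comp => //; apply: measurable_funM => //.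
  exact: measurableT_comp.
apply/funext => x; apply/eqP.
rewrite -(@eqrXn2 _ 2)// ?expR_ge0// ?sqrtr_ge0// sqr_sqrtr ?ltW//.
by rewrite -expRM_natr mulrAC mulVf// mul1r lnK// posrE.
Qed.

Section OneVariable.
Variables (s b c : R).
Hypothesis s0 : 0 < s.

Let m := - (b / s).
Let sigma := Num.sqrt (2 * s)^-1.
Let k := (Num.sqrt s)^-1 * expR (b ^+ 2 / s - c).

(** The factor [expR (x ^+ 2)] cancels the Gaussian weight. What remains is
    [- s (x + b / s)^2 + b^2 / s - c] in the exponent, a multiple of the normal density of mean
    [- b / s] and variance [1 / (2 s)]. *)
Let gauss_square x :
  gauss_weight x * expR (x ^+ 2 - (s * x ^+ 2 + 2 * b * x + c)) =
  k * normal_pdf m sigma x.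
Proof.
have s20 : 0 < (2 * s)^-1 by rewrite invr_gt0 mulr_gt0.
have sigma0 : sigma != 0 by rewrite gt_eqF// sqrtr_gt0.
rewrite normal_pdfE// /normal_peak /normal_fun.
rewrite sqr_sqrtr ?ltW//.
rewrite /gauss_weight /k.
rewrite -[LHS]mulrA -[X in _ * X = _]expRD [RHS]mulrACA -[X in _ = _ * X]expRD.
congr (_ * expR _); last by rewrite /m -mulr_natr; field; rewrite gt_eqF.
rewrite (_ : (2 * s)^-1 * pi *+ 2 = s^-1 * pi); last first.
  by rewrite -mulr_natr; field; rewrite gt_eqF.
rewrite sqrtrM ?invr_ge0 ?ltW// sqrtrV ?ltW// invfM invrK mulKf//.
by rewrite gt_eqF// sqrtr_gt0.
Qed.

Lemma integrable_gauss_square : mu.-integrable setT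
  (fun x => (gauss_weight x * expR (x ^+ 2 - (s * x ^+ 2 + 2 * b * x + c)))%:E).
Proof.
have := integrableZl (D := setT) measurableT k (integrable_normal_pdf m sigma).
by apply: eq_integrable => // x _; rewrite gauss_square EFinM.
Qed.

Lemma integral_gauss_square :
  (\int[mu]_x
     (gauss_weight x * expR (x ^+ 2 - (s * x ^+ 2 + 2 * b * x + c)))%:E
   = ((Num.sqrt s)^-1 * expR (b ^+ 2 / s - c))%:E)%E.
Proof.
under eq_integral do rewrite gauss_square EFinM.
rewrite integralZl//; last exact: integrable_normal_pdf.
by rewrite integral_normal_pdf mule1.
Qed.

End OneVariable.

Lemma gauss_pmean_square1 (s b c : R -> R) (f : R -> seq R -> R) :
  (forall t, 0 < s t) -> measurable_fun setT s ->
  measurable_fun setT b -> measurable_fun setT c ->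
  (forall t x, f t [:: x] =
     expR (x ^+ 2 - (s t * x ^+ 2 + 2 * b t * x + c t))) ->
  gauss_pmean 1 f
    (fun t => (Num.sqrt (s t))^-1 * expR (b t ^+ 2 / s t - c t)).
Proof.
move=> s0 ms mb mc fE.
exists (fun t x => f t [:: x]); split=> //.
- under eq_fun do rewrite fE.
  have mx : measurable_fun setT (fun p : R * R => p.2 ^+ 2).
    exact: measurable_funX.
  have lift (h : R -> R) : measurable_fun setT h ->
      measurable_fun setT (fun p : R * R => h p.1) by move=> ?; exact: measurableT_comp.
  apply: measurableT_comp => //; apply: measurable_funB => //.
  apply: measurable_funD; last exact: lift.
  apply: measurable_funD; first by apply: measurable_funM => //; exact: lift.
  by do 2 (apply: measurable_funM => //); exact: lift.
- by move=> t; under eq_fun do rewrite fE; exact: integrable_gauss_square.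
- by move=> t; under eq_integral do rewrite fE; exact: integral_gauss_square.
Qed.

(** [x] and [y] are the real and imaginary parts of one complex entry; the two factors [s^(-1/2)]
    multiply to [s^-1]. *)
Lemma gauss_pmean_square2 (s b d c : R -> R) (f : R -> seq R -> R) :
  (forall t, 0 < s t) -> measurable_fun setT s ->
  measurable_fun setT b -> measurable_fun setT d -> measurable_fun setT c ->
  (forall t x y, f t [:: x; y] = expR (x ^+ 2 + y ^+ 2
     - (s t * (x ^+ 2 + y ^+ 2) + 2 * (b t * x + d t * y) + c t))) ->
  gauss_pmean 2 f
    (fun t => (s t)^-1 * expR ((b t ^+ 2 + d t ^+ 2) / s t - c t)).
Proof.
move=> s0 ms mb md mc fE.
have msV := measurable_fun_inv_pos s0 ms.
have mr : measurable_fun setT (fun t => (Num.sqrt (s t))^-1).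
  apply: measurable_fun_inv_pos; first by move=> t; rewrite sqrtr_gt0.
  exact: measurable_fun_sqrt_pos.
(* What is left after integrating [y]: completing its square lowers the constant [c] by
   [d ^+ 2 / s]. *)
pose g t (l : seq R) := (Num.sqrt (s t))^-1 * expR (nth 0 l 0 ^+ 2 -
  (s t * nth 0 l 0 ^+ 2 + 2 * b t * nth 0 l 0 + (c t - d t ^+ 2 / s t))).
apply: (@gauss_pmean_cat R 1 1 f g).
  rewrite (_ : (fun t => _) = fun t => (Num.sqrt (s t))^-1 *
    ((Num.sqrt (s t))^-1 * expR (b t ^+ 2 / s t - (c t - d t ^+ 2 / s t)))).
    apply: gauss_pmeanZ => //; apply: gauss_pmean_square1 => //.
    apply: measurable_funB => //; apply: measurable_funM => //.
    exact: measurable_funX.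
  apply/funext => t; rewrite mulrA -invfM -expr2 sqr_sqrtr ?ltW//.
  by congr (_ * expR _); field; rewrite gt_eqF.
move=> [|x [|]]// _.
rewrite (_ : (fun t => _) = fun t => (Num.sqrt (s t))^-1 * expR (d t ^+ 2 / s t
   - (c t + 2 * b t * x + s t * x ^+ 2 - x ^+ 2))).
  apply: gauss_pmean_square1 => //.
    apply: measurable_funB => //; apply: measurable_funD; last first.
      exact: measurable_funM.
    by apply: measurable_funD => //; do 2 (apply: measurable_funM => //).
  by move=> t y; rewrite fE; congr expR; ring.
by apply/funext => t; rewrite /g /=; congr (_ * expR _); ring.
Qed.

End GaussianIntegral.

(** * Frullani's formula and integrals over the half line *)

Section HalfLine.
Context (R : realType).
Local Notation mu := (@lebesgue_measure R).

Lemma integral_is_derive (f F : R -> R) (a b : R) : a <= b ->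
  (forall x, a <= x <= b -> {for x, continuous f}) ->
  (forall x, a <= x <= b -> is_derive x 1 F (f x)) ->
  (\int[mu]_(x in `[a, b]) (f x)%:E = (F b - F a)%:E)%E.
Proof.
rewrite le_eqVlt => /predU1P[<- _ _|ab cf dF].
  by rewrite set_itv1 integral_set1 subrr.
have cF x : a <= x <= b -> {for x, continuous F}.
  by move=> /dF dFx; apply/differentiable_continuous/derivable1_diffP.
rewrite (@continuous_FTC2 R f F a b) ?EFinB//.
- apply: continuous_in_subspaceT => x; rewrite inE/= in_itv/=; exact: cf.
- split.
  + by move=> x; rewrite in_itv/= => /andP[/ltW ax /ltW xb];
      have [] := dF x; rewrite ?ax ?xb.
  + by apply: cvg_at_right_filter; apply: cF; rewrite lexx ltW.
  + by apply: cvg_at_left_filter; apply: cF; rewrite lexx ltW.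
- move=> x; rewrite in_itv/= => /andP[/ltW ax /ltW xb].
  by rewrite derive1E; apply: derive_val; apply: dF; rewrite ax.
Qed.

Lemma integral_is_derivey (f F : R -> R) (a l : R) :
  (forall x, a <= x -> 0 <= f x) ->
  (forall x, a <= x -> {for x, continuous f}) ->
  (forall x, a <= x -> is_derive x 1 F (f x)) ->
  F x @[x --> +oo] --> l ->
  (\int[mu]_(x in `]a, +oo[) (f x)%:E = (l - F a)%:E)%E.
Proof.
move=> f0 cf dF Fl.
have cf' : {within `[a, +oo[, continuous f}.
  by apply: continuous_in_subspaceT => x; rewrite inE/= in_itv/= andbT; exact: cf.
rewrite integral_itv_obnd_cbnd; last first.
  apply/measurable_EFinP; apply: open_continuous_measurable_fun => //.
  by move=> x; rewrite inE/= in_itv/= andbT => /ltW; exact: cf.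
rewrite (@ge0_continuous_FTC2y R f F a l) ?EFinB//.
- by move=> x /ltW ax; have [] := dF x ax.
- apply: cvg_at_right_filter; apply/differentiable_continuous.
  by apply/derivable1_diffP; have [] := dF a (lexx _).
- move=> x; rewrite in_itv/= andbT => /ltW ax.
  by rewrite derive1E; apply: derive_val; exact: dF.
Qed.

(** The cut-off turns integrals over [t > 0] into integrals over the whole line, the only ones
    [gauss_pmean_mean] deals with. *)
Definition pos_inv : R -> R := (fun t : R => t^-1) \_ `]0, +oo[.

Lemma pos_invE t : 0 < t -> pos_inv t = t^-1.
Proof. by move=> t0; rewrite /pos_inv patchE ifT// inE/= in_itv/= t0. Qed.

Lemma pos_inv_ge0 t : 0 <= pos_inv t.
Proof.
apply: restrict_ge0 => x /=; rewrite in_itv/= andbT => /ltW.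
by rewrite invr_ge0.
Qed.

Lemma pos_inv0 t : t <= 0 -> pos_inv t = 0.
Proof.
move=> t0; rewrite /pos_inv patchE ifF//.
by apply/negbTE; rewrite notin_setE/= in_itv/= andbT; apply/negP; rewrite -leNgt.
Qed.

Lemma measurable_pos_inv : measurable_fun setT pos_inv.
Proof.
rewrite /pos_inv; rewrite (_ : _ \_ _ = (fun t => expR (- ln t)) \_ `]0, +oo[).
  apply/measurable_restrict => //; apply: measurable_funTS.
  apply: measurableT_comp => //; apply: measurableT_comp => //.
apply/funext => t; rewrite !patchE; case: ifPn => //.
by rewrite inE/= in_itv/= andbT => t0; rewrite expRN lnK// posrE.
Qed.

Lemma continuous_expRM (t : R) : continuous (fun s => expR (- (t * s))).
Proof.
move=> s; apply: continuous_comp; last exact: continuous_expR.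
by apply: continuousN; apply: continuousM; [exact: cst_continuous|].
Qed.

Lemma is_derive_expRM (t s : R) : t != 0 ->
  is_derive s 1 (fun s => - t^-1 * expR (- (t * s))) (expR (- (t * s))).
Proof.
move=> t0; apply: is_derive_eq; rewrite /GRing.scale/=; field.
by rewrite t0.
Qed.

(** For [t > 0] the integrand is the integral of [exp (- t s)] over [s] in [[q, r]]. Exchanging the
    integrals leaves that of [1 / s] over [[q, r]]. *)
Lemma frullani_expR (q r : R) : 0 < q -> q <= r ->
  \int[mu]_t (pos_inv t * (expR (- (t * q)) - expR (- (t * r)))) = ln r - ln q.
Proof.
move=> q0 qr.
pose F (p : R * R) : R :=
  \1_(`]0, +oo[ : set R) p.1 * (\1_(`[q, r] : set R) p.2 * expR (- (p.1 * p.2))).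
have mF : measurable_fun setT (EFin \o F).
  apply/measurable_EFinP; apply: measurable_funM.
    by apply: measurableT_comp => //; exact: measurable_indic.
  apply: measurable_funM.
    by apply: measurableT_comp => //; exact: measurable_indic.
  apply: measurableT_comp => //; apply: measurableT_comp => //.
  exact: measurable_funM.
have F0 p : (0 <= (EFin \o F) p)%E by rewrite lee_fin !mulr_ge0 ?expR_ge0.
have := fubini_tonelli (m1 := mu) (m2 := mu) _ mF F0.
rewrite [LHS](_ : _ = \int[mu]_t
    (pos_inv t * (expR (- (t * q)) - expR (- (t * r))))%:E)%E; last first.
  apply: eq_integral => t _; rewrite /F /=; have [t0|t0] := ltP 0 t; last first.
    rewrite pos_inv0// mul0r integral0_eq// => s _.
    by rewrite indicE memNset ?mul0r//= in_itv/= andbT; apply/negP; rewrite -leNgt.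
  rewrite indicE mem_set/= ?in_itv/= ?t0//.
  rewrite [LHS](_ : _ = \int[mu]_(s in `[q, r]) (expR (- (t * s)))%:E)%E; last first.
    rewrite [RHS]integral_mkcond; apply: eq_integral => s _.
    by rewrite patchE indicE mul1r; case: ifPn => _ /=; rewrite ?mul1r ?mul0r.
  rewrite (@integral_is_derive _ _ _ _ qr (fun s _ => @continuous_expRM t s)
    (fun s _ => @is_derive_expRM t s (lt0r_neq0 t0))).
  by rewrite pos_invE//; congr EFin; ring.
rewrite [RHS](_ : _ = (ln r - ln q)%:E)%E; last first.
  have cinv x : q <= x <= r -> {for x, continuous (@GRing.inv R)}.
    by move=> /andP[qx _]; apply: inv_continuous; rewrite gt_eqF// (lt_le_trans q0).
  have dln x : q <= x <= r -> is_derive x 1 (@ln R) x^-1.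
    by move=> /andP[qx _]; apply: is_derive1_ln; exact: lt_le_trans qx.
  rewrite -(integral_is_derive qr cinv dln).
  rewrite [RHS]integral_mkcond; apply: eq_integral => s _; rewrite patchE /F /=.
  have [sqr|sqr] := boolP (s \in _); last first.
    rewrite integral0_eq// => t _.
    by rewrite (indicE _ _ s) (negbTE sqr) mul0r mulr0.
  rewrite (indicE _ _ s) sqr/=.
  have s0 : 0 < s.
    by move: sqr; rewrite inE/= in_itv/= => /andP[qs _]; exact: lt_le_trans qs.
  rewrite [LHS](_ : _ = \int[mu]_(t in `]0%R, +oo[) (expR (- (t * s)))%:E)%E; last first.
    rewrite [RHS]integral_mkcond; apply: eq_integral => t _.
    by rewrite patchE indicE mul1r; case: ifPn => _ /=; rewrite ?mul1r ?mul0r.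
  have sE : (fun t => (expR (- (t * s)))%:E) = (fun t => (expR (- (s * t)))%:E).
    by apply/funext => t; rewrite mulrC.
  rewrite sE (@integral_is_derivey _ _ 0 0 (fun t _ => expR_ge0 _)
    (fun t _ => @continuous_expRM s t)
    (fun t _ => @is_derive_expRM s t (lt0r_neq0 s0))).
    by rewrite mulr0 oppr0 expR0 mulr1 sub0r opprK.
  rewrite -[X in _ --> X](mulr0 (- s^-1)); apply: cvgMr.
  apply: (cvg_comp (fun t => s * t) (fun x => expR (- x))); last exact: cvgr_expR.
  exact: gt0_cvgMry.
by move=> E; rewrite /Rintegral E.
Qed.

Lemma integral_onep_pow (n : nat) : (0 < n)%N ->
  (\int[mu]_(t in `]0%R, +oo[) (((1 + t)^-1 ^+ n.+1)%:E) = (n%:R^-1)%:E)%E.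
Proof.
move=> n0; have nz : (n%:R : R) != 0 by rewrite pnatr_eq0 -lt0n.
have p0 (t : R) : 0 <= t -> 1 + t != 0 by move=> t0; rewrite gt_eqF// ltr_wpDr.
have cV (t : R) : 0 <= t -> {for t, continuous (fun t : R => (1 + t)^-1)}.
  move=> t0; apply: continuousV; first exact: p0.
  by apply: continuousD; [exact: cst_continuous|].
have f0 (t : R) : 0 <= t -> 0 <= (1 + t)^-1 ^+ n.+1.
  by move=> t0; rewrite exprn_ge0// invr_ge0 addr_ge0.
have cf (t : R) : 0 <= t -> {for t, continuous (fun t : R => (1 + t)^-1 ^+ n.+1)}.
  by move=> t0; exact: (@continuous_comp _ _ _ _ (fun x : R => x ^+ n.+1) t (cV t t0) (@exprn_continuous _ n.+1 _)).
have dF (t : R) : 0 <= t ->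
    is_derive t 1 (fun t : R => - n%:R^-1 * (1 + t)^-1 ^+ n) ((1 + t)^-1 ^+ n.+1).
  move=> t0; have h := p0 t t0.
  have dV : is_derive t 1 (fun t : R => (1 + t)^-1) (- (1 + t) ^- 2).
    have d1 : is_derive t 1 (fun t : R => 1 + t) 1.
      rewrite (_ : (fun t : R => 1 + t) = cst 1 + id)//.
      by apply: is_derive_eq; rewrite add0r.
    have := is_deriveV (f := fun t : R => 1 + t) h d1.
    by rewrite /GRing.scale/= mulr1.
  move: n n0 nz {f0 cf} => [//|m] _ nz.
  have := is_deriveZ (- m.+1%:R^-1) (is_deriveX m.+1 dV).
  have -> : - m.+1%:R^-1 \*: (fun t : R => (1 + t)^-1) ^+ m.+1 =
      (fun t : R => - m.+1%:R^-1 * (1 + t)^-1 ^+ m.+1).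
    by apply/funext => u; rewrite /= exprfctE.
  rewrite (_ : _ *: _ = (1 + t)^-1 ^+ m.+2)//.
  rewrite /GRing.scale/= !exprS; move: (m.+1%:R) nz => k nz.
  by field; rewrite nz h.
have Fl : (- n%:R^-1 * (1 + t)^-1 ^+ n) @[t --> +oo] --> (0 : R).
  rewrite -[X in _ --> X](mulr0 (- n%:R^-1)); apply: cvgMr.
  rewrite -[X in _ --> X](_ : 0 ^+ n = 0 :> R); last by rewrite expr0n gtn_eqF.
  apply: (cvg_comp (fun t => (1 + t)^-1) (fun x => x ^+ n)); last first.
    exact: exprn_continuous.
  apply/gtr0_cvgV0; last exact: cvg_addrl.
  by near=> t; rewrite addr_gt0//; near: t; exact: nbhs_pinfty_gt.
rewrite (integral_is_derivey f0 cf dF Fl).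
by rewrite addr0 invr1 expr1n mulr1 sub0r opprK.
Unshelve. all: by end_near. Qed.

(** With [x = 1 / (1 + t)] the difference telescopes into terms [x^j (1 - x)], and
    [(1 - x) / t = x]. For [t <= 0] both sides vanish. *)
Lemma pos_inv_powB (m n : nat) (t : R) : (m <= n)%N ->
  pos_inv t * ((1 + Num.max t 0)^-1 ^+ m - (1 + Num.max t 0)^-1 ^+ n) =
  \sum_(m <= j < n) ((fun t : R => (1 + t)^-1 ^+ j.+1) \_ `]0, +oo[) t.
Proof.
move=> mn; have [t0|t0] := ltP 0 t; last first.
  rewrite pos_inv0// mul0r big1// => j _; rewrite patchE ifF//.
  by apply/negbTE; rewrite notin_setE/= in_itv/= andbT; apply/negP; rewrite -leNgt.
rewrite pos_invE// -[_ - _]opprB -(telescope_sumr (fun j => (1 + t)^-1 ^+ j))//.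
rewrite -sumrN mulr_sumr; apply: eq_bigr => j _.
rewrite patchE ifT; last by rewrite inE/= in_itv/= t0.
have h : 1 + t != 0 by rewrite gt_eqF// addr_gt0.
have h' : t != 0 by rewrite gt_eqF.
by rewrite exprS; field; rewrite h h'.
Qed.

Lemma integrable_pos_inv_pow (m n : nat) : (0 < m)%N -> (m <= n)%N ->
  mu.-integrable setT (fun t => (pos_inv t *
    ((1 + Num.max t 0)^-1 ^+ m - (1 + Num.max t 0)^-1 ^+ n))%:E) /\
  \int[mu]_t (pos_inv t *
    ((1 + Num.max t 0)^-1 ^+ m - (1 + Num.max t 0)^-1 ^+ n)) =
  \sum_(m <= j < n) j%:R^-1.
Proof.
move=> m0 mn.
pose g j : R -> R := (fun t : R => (1 + t)^-1 ^+ j.+1) \_ `]0, +oo[.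
have g0 j t : 0 <= g j t.
  apply: restrict_ge0 => x /=; rewrite in_itv/= andbT => x0.
  by rewrite exprn_ge0// invr_ge0 addr_ge0// ltW.
have mg j : measurable_fun setT (g j).
  apply/measurable_restrict => //; rewrite setTI.
  apply: open_continuous_measurable_fun => //.
  move=> x; rewrite inE/= in_itv/= andbT => x0.
  apply: (@continuous_comp _ _ _ (fun x : R => (1 + x)^-1) (fun x : R => x ^+ j.+1));
    last exact: exprn_continuous.
  apply: continuousV; first by rewrite gt_eqF// addr_gt0.
  by apply: continuousD; [exact: cst_continuous|].
have Ig j : (0 < j)%N -> (\int[mu]_t (g j t)%:E = (j%:R^-1)%:E)%E.
  move=> j0; rewrite -integral_onep_pow// [RHS]integral_mkcond.
  by apply: eq_integral => t _; rewrite /g !patchE; case: ifP.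
have ig j : (0 < j)%N -> mu.-integrable setT (fun t => (g j t)%:E).
  move=> j0; apply/integrableP; split; first by apply/measurable_EFinP; exact: mg.
  rewrite [ltLHS](_ : _ = (j%:R^-1)%:E) ?ltry// -Ig//.
  by apply: eq_integral => t _; rewrite gee0_abs// lee_fin.
(* The shift by one makes every index a successor; [g 0], which is [1 / (1 + t)] on the half line,
   would not be integrable. *)
have E t : ((pos_inv t *
    ((1 + Num.max t 0)^-1 ^+ m - (1 + Num.max t 0)^-1 ^+ n))%:E =
    \sum_(m.-1 <= j < n.-1) (g j.+1 t)%:E)%E.
  by rewrite pos_inv_powB// -[m in LHS](prednK m0) big_add1 sumEFin.
split.
  under eq_fun do rewrite E.
  by apply: integrable_sum => // j _; exact: ig.
rewrite /Rintegral; under eq_integral do rewrite E.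
rewrite integral_sum//=; last by move=> j; exact: ig.
under eq_bigr do rewrite Ig//.
by rewrite sumEFin/= -[m in RHS](prednK m0) big_add1.
Qed.

End HalfLine.

(** * Hermitian matrices and Gram determinants *)

Section HermitianMatrices.
Context (R : realType).
Local Notation C := R[i].
Local Notation Re := (@complex.Re R).
Local Notation Im := (@complex.Im R).

Lemma ReD (x y : C) : Re (x + y) = Re x + Re y.
Proof. by case: x y => [a b] [c d]. Qed.

Lemma ImD (x y : C) : Im (x + y) = Im x + Im y.
Proof. by case: x y => [a b] [c d]. Qed.

Lemma Re_sum I (r : seq I) (P : pred I) (f : I -> C) :
  Re (\sum_(i <- r | P i) f i) = \sum_(i <- r | P i) Re (f i).
Proof. exact: (big_morph Re ReD (erefl _)). Qed.

Lemma ReB (x y : C) : Re (x - y) = Re x - Re y.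
Proof. by case: x y => [a b] [c d]. Qed.

Lemma ReM (x y : C) : Re (x * y) = Re x * Re y - Im x * Im y.
Proof. by case: x y => [a b] [c d]. Qed.

Lemma ImM (x y : C) : Im (x * y) = Re x * Im y + Im x * Re y.
Proof. by case: x y => [a b] [c d]. Qed.

Lemma ReCM (r : R) (x : C) : Re (r%:C%C * x) = r * Re x.
Proof. by rewrite ReM /= mul0r subr0. Qed.

Lemma hadjE m n (A : 'M[C]_(m, n)) i j : hadj A i j = (A j i)^*.
Proof. by rewrite !mxE. Qed.

(** Bridge to the conjugate transpose used by [normalmx] and [unitarymx]. *)
Lemma hadj_trmxC m n (A : 'M[C]_(m, n)) : hadj A = map_mx Num.conj A^T.
Proof. by apply/matrixP => i j; rewrite !mxE. Qed.

Lemma hadjK m n : cancel (@hadj R m n) (@hadj R n m).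
Proof. by move=> A; apply/matrixP => i j; rewrite !hadjE conjCK. Qed.

Lemma hadjM m n p (A : 'M[C]_(m, n)) (B : 'M[C]_(n, p)) :
  hadj (A *m B) = hadj B *m hadj A.
Proof. by rewrite /hadj map_mxM trmx_mul. Qed.

Lemma hadjD m n (A B : 'M[C]_(m, n)) : hadj (A + B) = hadj A + hadj B.
Proof. by rewrite /hadj map_mxD linearD. Qed.

Lemma hadjN m n (A : 'M[C]_(m, n)) : hadj (- A) = - hadj A.
Proof. by rewrite /hadj map_mxN linearN. Qed.

Lemma hadj0 m n : hadj (0 : 'M[C]_(m, n)) = 0.
Proof. by rewrite /hadj map_mx0 trmx0. Qed.

Lemma hadj1 n : hadj (1%:M : 'M[C]_n) = 1%:M.
Proof. by rewrite /hadj map_mx1 trmx1. Qed.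

Lemma hadjZ m n (a : C) (A : 'M[C]_(m, n)) : hadj (a *: A) = a^* *: hadj A.
Proof. by apply/matrixP => i j; rewrite !mxE rmorphM. Qed.

Lemma hadj_row_mx m n p (A : 'M[C]_(m, n)) (B : 'M[C]_(m, p)) :
  hadj (row_mx A B) = col_mx (hadj A) (hadj B).
Proof. by rewrite /hadj map_row_mx tr_row_mx. Qed.

Lemma hadj_col_mx m n p (A : 'M[C]_(m, p)) (B : 'M[C]_(n, p)) :
  hadj (col_mx A B) = row_mx (hadj A) (hadj B).
Proof. by rewrite /hadj map_col_mx tr_col_mx. Qed.

Lemma hadj_invmx n (A : 'M[C]_n) : hadj (invmx A) = invmx (hadj A).
Proof. by rewrite /hadj map_invmx trmx_inv. Qed.

Lemma det_hadj n (A : 'M[C]_n) : \det (hadj A) = (\det A)^*.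
Proof. by rewrite /hadj det_tr det_map_mx. Qed.

Lemma hadj_scalar n (a : C) : hadj (a%:M : 'M[C]_n) = (a^*)%:M.
Proof. by rewrite -scalemx1 hadjZ hadj1 scalemx1. Qed.

Lemma mulmx_hadj_ge0 n (u : 'rV[C]_n) : 0 <= (u *m hadj u) 0 0.
Proof. by rewrite mxE sumr_ge0// => i _; rewrite hadjE mul_conjC_ge0. Qed.

Lemma mulmx_hadj_eq0 n (u : 'rV[C]_n) : ((u *m hadj u) 0 0 == 0) = (u == 0).
Proof.
apply/idP/eqP => [|->]; last by rewrite mul0mx mxE.
rewrite mxE psumr_eq0 => [/allP h|i _]; last by rewrite hadjE mul_conjC_ge0.
apply/rowP => i; have := h i; rewrite mem_index_enum => /(_ isT).
by rewrite hadjE mul_conjC_eq0 mxE => /eqP.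
Qed.

Lemma psd_rowP n (Q : 'M[C]_n) :
  psd Q <-> hadj Q = Q /\ forall u : 'rV[C]_n, 0 <= (u *m Q *m hadj u) 0 0.
Proof.
split=> -[hQ h]; split=> // u; last by have := h (hadj u); rewrite hadjK.
by have := h (hadj u); rewrite hadjK.
Qed.

Lemma psd_conj m n (A : 'M[C]_(m, n)) (Q : 'M[C]_n) :
  psd Q -> psd (A *m Q *m hadj A).
Proof.
move=> /psd_rowP[hQ h]; apply/psd_rowP; split=> [|u].
  by rewrite !hadjM hadjK hQ mulmxA.
by have := h (u *m A); rewrite hadjM !mulmxA.
Qed.

Lemma psd_conjV m n (A : 'M[C]_(n, m)) (Q : 'M[C]_n) :
  psd Q -> psd (hadj A *m Q *m A).
Proof. by move=> /(psd_conj (hadj A)); rewrite hadjK. Qed.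

Lemma psd_scalar n (a : C) : 0 <= a -> psd (a%:M : 'M[C]_n).
Proof.
move=> a0; apply/psd_rowP; split=> [|u].
  by rewrite hadj_scalar geC0_conj.
by rewrite mul_mx_scalar -scalemxAl mxE mulr_ge0// mulmx_hadj_ge0.
Qed.

Lemma psd1 n : psd (1%:M : 'M[C]_n).
Proof. by apply: psd_scalar; exact: ler01. Qed.

Lemma psd_gram m n (A : 'M[C]_(m, n)) : psd (A *m hadj A).
Proof. by have := psd_conj A (psd1 n); rewrite mulmx1. Qed.

Lemma psdD n (P Q : 'M[C]_n) : psd P -> psd Q -> psd (P + Q).
Proof.
move=> /psd_rowP[hP p] /psd_rowP[hQ q]; apply/psd_rowP; split=> [|u].
  by rewrite hadjD hP hQ.
by rewrite mulmxDr mulmxDl mxE addr_ge0.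
Qed.

Lemma psd0 n : psd (0 : 'M[C]_n).
Proof. by have := @psd_scalar n 0 (lexx _); rewrite raddf0. Qed.

Lemma psd_sum n I (r : seq I) (P : pred I) (Q : I -> 'M[C]_n) :
  (forall i, P i -> psd (Q i)) -> psd (\sum_(i <- r | P i) Q i).
Proof. by move=> h; apply: (big_ind (@psd R n)) h; [exact: psd0|exact: psdD]. Qed.

Lemma psdZ n (a : C) (Q : 'M[C]_n) : 0 <= a -> psd Q -> psd (a *: Q).
Proof.
move=> a0 /psd_rowP[hQ q]; apply/psd_rowP; split=> [|u].
  by rewrite hadjZ hQ geC0_conj.
by rewrite -scalemxAr -scalemxAl mxE mulr_ge0.
Qed.

Lemma psd_spectral n (Q : 'M[C]_n) : psd Q ->
  exists (U : 'M[C]_n) (d : 'rV[C]_n), [/\ U *m hadj U = 1%:M,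
    hadj U *m U = 1%:M, forall i, 0 <= d 0 i & Q = hadj U *m diag_mx d *m U].
Proof.
move=> /psd_rowP[hQ q].
have nQ : Q \is normalmx by apply/normalmxP; rewrite -hadj_trmxC hQ.
have uU := spectral_unitarymx Q.
have UU : spectralmx Q *m hadj (spectralmx Q) = 1%:M.
  by rewrite hadj_trmxC; exact/unitarymxP.
have UU' : hadj (spectralmx Q) *m spectralmx Q = 1%:M by exact: mulmx1C.
have QE : Q = hadj (spectralmx Q) *m diag_mx (spectral_diag Q) *m spectralmx Q.
  rewrite -[hadj (spectralmx Q)](mulmxK (spectral_unit Q)) UU' mul1mx.
  by have /orthomx_spectralP E := nQ; exact: E.
exists (spectralmx Q), (spectral_diag Q); split=> // i.
(* The [i]-th eigenvalue is the value of the form at the [i]-th row of the unitary matrix. *)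
have := q (row i (spectralmx Q)); rewrite {2}QE.
set U := spectralmx Q in UU *; set d := spectral_diag Q.
have -> : row i U *m (hadj U *m diag_mx d *m U) *m hadj (row i U) =
    (delta_mx 0 i *m diag_mx d) *m hadj (delta_mx 0 i).
  rewrite rowE hadjM !mulmxA -(mulmxA _ U (hadj U)) UU mulmx1.
  by rewrite -(mulmxA _ U (hadj U)) UU mulmx1.
have -> : hadj (delta_mx 0 i : 'rV[C]_n) = delta_mx i 0.
  by apply/matrixP => j k; rewrite hadjE !mxE conjC_nat andbC.
by rewrite -rowE row_diag_mx -scalemxAl mul_delta_mx mxE mxE !eqxx mulr1.
Qed.

End HermitianMatrices.

(** * Schur complements, determinant bounds and kernel projections *)

Section Determinants.

Lemma det_schur (F : comUnitRingType) m n (A : 'M[F]_m) (B : 'M[F]_(m, n))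
    (D : 'M[F]_(n, m)) (E : 'M[F]_n) : A \in unitmx ->
  \det (block_mx A B D E) = \det A * \det (E - D *m invmx A *m B).
Proof.
move=> uA.
have -> : block_mx A B D E = block_mx A 0 D (E - D *m invmx A *m B) *m
    block_mx 1%:M (invmx A *m B) 0 1%:M.
  rewrite mulmx_block !mulmx1 ?mulmx0 ?mul0mx !addr0 mulmxA mulmxV// mul1mx.
  by rewrite mulmxA addrC subrK.
by rewrite det_mulmx det_lblock det_ublock !det1 !mulr1.
Qed.

Lemma det_schur_dr (F : comUnitRingType) m n (A : 'M[F]_m) (B : 'M[F]_(m, n))
    (D : 'M[F]_(n, m)) (E : 'M[F]_n) : E \in unitmx ->
  \det (block_mx A B D E) = \det E * \det (A - B *m invmx E *m D).
Proof.
move=> uE.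
have -> : block_mx A B D E = block_mx 1%:M (B *m invmx E) 0 1%:M *m
    block_mx (A - B *m invmx E *m D) 0 D E.
  rewrite mulmx_block !mul1mx ?mulmx0 ?mul0mx !add0r.
  by rewrite subrK -mulmxA mulVmx// mulmx1.
by rewrite det_mulmx det_lblock det_ublock !det1 !mul1r mulrC.
Qed.

(** One block matrix with identity diagonal blocks, expanded along either of its two Schur
    complements. *)
Lemma det_1mul_comm (F : comUnitRingType) m n (A : 'M[F]_(m, n))
    (B : 'M[F]_(n, m)) :
  \det (1%:M + A *m B) = \det (1%:M + B *m A).
Proof.
have := det_schur (A := 1%:M) (- A) B 1%:M (unitmx1 _ _).
rewrite det_schur_dr ?unitmx1// !det1 !mul1r !invmx1 !mulmx1.
by rewrite mulNmx mulmxN !opprK.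
Qed.

Section Positive.
Context (R : realType).
Local Notation C := R[i].

Lemma det_spectral n (U : 'M[C]_n) (D : 'M[C]_n) : hadj U *m U = 1%:M ->
  \det (hadj U *m D *m U) = \det D.
Proof.
move=> UU; rewrite !det_mulmx mulrAC -det_mulmx UU det1 mul1r//.
Qed.

Lemma det_psd_ge0 n (Q : 'M[C]_n) : psd Q -> 0 <= \det Q.
Proof.
move=> /psd_spectral[U [d [_ UU d0 ->]]].
by rewrite det_spectral// det_diag prodr_ge0.
Qed.

Lemma det_psd_le n (Q : 'M[C]_n) : psd Q -> \det Q <= (\tr Q / n%:R) ^+ n.
Proof.
move=> /psd_spectral[U [d [UU UU' d0 ->]]].
rewrite det_spectral// det_diag mxtrace_mulC mulmxA UU mul1mx mxtrace_diag.
have [+ _] := @leif_AGM C 'I_n xpredT (d 0) (fun i _ => d0 i).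
rewrite (eq_card (_ : _ =i 'I_n))// card_ord.
have -> : \prod_(i in xpredT) d 0 i = \prod_i d 0 i by apply: eq_bigl.
by have -> : \sum_(i in xpredT) d 0 i = \sum_i d 0 i by apply: eq_bigl.
Qed.

(** Eigenvalue by eigenvalue, [1 + p d >= p d]. This gives the lower bounds on both rates. *)
Lemma det_1Dscale_ge n (W : 'M[C]_n) (p : C) : 0 <= p -> psd W ->
  p ^+ n * \det W <= \det (1%:M + p *: W).
Proof.
move=> p0 /psd_spectral[U [d [UU UU' d0 ->]]].
have -> : 1%:M + p *: (hadj U *m diag_mx d *m U) =
    hadj U *m diag_mx (const_mx 1 + p *: d) *m U.
  rewrite linearD/= mulmxDr mulmxDl diag_const_mx mulmx1 UU'; congr (_ + _).
  by rewrite linearZ/= -scalemxAr -scalemxAl.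
rewrite !det_spectral// !det_diag -[n in p ^+ n]card_ord -prodr_const -big_split/=.
apply: ler_prod => i _; rewrite mulr_ge0/= ?d0//= !mxE.
by rewrite lerDr ler01.
Qed.

Lemma psd_invmx_factor n (W : 'M[C]_n) : psd W -> W \in unitmx ->
  exists T : 'M[C]_n, invmx W = hadj T *m T.
Proof.
move=> /psd_spectral[U [d [UU UU' d0 WE]]] uW.
have dn0 i : d 0 i != 0.
  move: uW; rewrite WE unitmxE det_spectral// det_diag unitfE.
  by move=> /prodf_neq0; apply.
pose T := diag_mx (\row_i sqrtC (d 0 i)^-1) *m U.
exists T; have WT : W *m (hadj T *m T) = 1%:M.
  have TT : hadj T *m T = hadj U *m diag_mx (\row_i (d 0 i)^-1) *m U.
    rewrite hadjM -!mulmxA; congr (_ *m _); rewrite !mulmxA; congr (_ *m _).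
    have -> : hadj (diag_mx (\row_i sqrtC (d 0 i)^-1)) =
        diag_mx (\row_i sqrtC (d 0 i)^-1).
      apply/matrixP => i j; rewrite hadjE !mxE; case: eqVneq => [->|].
        by rewrite ?eqxx !mulr1n geC0_conj// sqrtC_ge0 invr_ge0.
      by rewrite !mulr0n conjC0.
    rewrite mulmx_diag; congr diag_mx; apply/rowP => i.
    by rewrite !mxE -expr2 sqrtCK.
  rewrite WE TT !mulmxA -(mulmxA _ U (hadj U)) UU mulmx1.
  rewrite -(mulmxA (hadj U)) mulmx_diag.
  have -> : diag_mx (\row_i (d 0 i * (\row_i0 (d 0 i0)^-1) 0 i)) = 1%:M :> 'M[C]_n.
    rewrite -diag_const_mx; congr diag_mx; apply/rowP => i.
    by rewrite !mxE mulfV.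
  by rewrite mulmx1.
by apply: (can_inj (mulKmx uW)); rewrite mulmxV // WT.
Qed.

Lemma psd_unit_det_gt0 n (W : 'M[C]_n) : psd W -> W \in unitmx -> 0 < \det W.
Proof.
move=> pW; rewrite unitmxE unitfE => h.
by rewrite lt_def h det_psd_ge0.
Qed.

(** [invmx W *m X] need not be Hermitian, but writing [invmx W] as [hadj T *m T] gives it the
    determinant and trace of the positive semidefinite [T *m X *m hadj T]. *)
Lemma det_invmx_mul_psd n (W X : 'M[C]_n) : psd W -> W \in unitmx -> psd X ->
  0 <= \det (invmx W *m X) <= (\tr (invmx W *m X) / n%:R) ^+ n.
Proof.
move=> pW uW pX; have [T ->] := psd_invmx_factor pW uW.
have -> : \det (hadj T *m T *m X) = \det (T *m X *m hadj T).
  by rewrite !det_mulmx mulrAC mulrC mulrA mulrAC.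
have -> : \tr (hadj T *m T *m X) = \tr (T *m X *m hadj T).
  by rewrite -mulmxA mxtrace_mulC.
have pTX : psd (T *m X *m hadj T) by exact: psd_conj.
by apply/andP; split; [exact: det_psd_ge0|exact: det_psd_le].
Qed.

Lemma psd_invmx n (W : 'M[C]_n) : psd W -> W \in unitmx -> psd (invmx W).
Proof.
move=> pW uW; have [T ->] := psd_invmx_factor pW uW.
by have := psd_gram (hadj T); rewrite hadjK.
Qed.

(* The orthogonal projection onto the kernel of [A] when [A A^H] is invertible;
   otherwise [invmx] is a junk value. *)
Definition nullproj m n (A : 'M[C]_(m, n)) : 'M[C]_n :=
  1%:M - hadj A *m invmx (A *m hadj A) *m A.

Lemma hadj_gram m n (A : 'M[C]_(m, n)) : hadj (A *m hadj A) = A *m hadj A.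
Proof. by rewrite hadjM hadjK. Qed.

Lemma hadj_nullproj m n (A : 'M[C]_(m, n)) : hadj (nullproj A) = nullproj A.
Proof.
by rewrite /nullproj hadjD hadjN hadj1 !hadjM hadjK hadj_invmx hadj_gram mulmxA.
Qed.

Section NullProj.
Variables (m n : nat) (A : 'M[C]_(m, n)).
Hypothesis uA : A *m hadj A \in unitmx.

Lemma mul_nullproj : A *m nullproj A = 0.
Proof.
by rewrite /nullproj mulmxBr mulmx1 !mulmxA mulmxV// mul1mx subrr.
Qed.

Lemma nullproj_mul : nullproj A *m hadj A = 0.
Proof. by rewrite -[LHS]hadjK hadjM hadjK hadj_nullproj mul_nullproj hadj0. Qed.

Lemma nullproj_id p (X : 'M[C]_(n, p)) : A *m X = 0 -> nullproj A *m X = X.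
Proof. by move=> AX; rewrite /nullproj mulmxBl mul1mx -(mulmxA _ A X) AX mulmx0 subr0. Qed.

Lemma nullproj_idem : nullproj A *m nullproj A = nullproj A.
Proof. by rewrite nullproj_id// mul_nullproj. Qed.

Lemma psd_nullproj : psd (nullproj A).
Proof.
by rewrite -nullproj_idem -{2}hadj_nullproj; exact: psd_gram.
Qed.

(** The Schur complement of [A *m hadj A] in the stacked Gram matrix is the compression of
    [nullproj A] to the new rows. It serves for a single row and for a whole block. *)
Lemma det_gram_col_mx p (B : 'M[C]_(p, n)) :
  \det (col_mx A B *m hadj (col_mx A B)) =
  \det (A *m hadj A) * \det (B *m nullproj A *m hadj B).
Proof.
rewrite hadj_col_mx mul_col_row (det_schur _ _ _ uA); congr (_ * \det _).
by rewrite /nullproj mulmxBr mulmx1 mulmxBl !mulmxA.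
Qed.

(** After [1 + t] is factored out, [det_1mul_comm] turns the rest into [(1 + t)^-1] times the
    identity of size [m]. The rank of the projection thus appears as [n - m] without
    diagonalization. *)
Lemma det_1Dnullproj (t : C) : 1 + t != 0 ->
  \det (1%:M + t *: nullproj A) = (1 + t) ^+ n / (1 + t) ^+ m.
Proof.
move=> t1.
have -> : 1%:M + t *: nullproj A = (1 + t) *:
    (1%:M + (- (t / (1 + t)) *: hadj A) *m (invmx (A *m hadj A) *m A)).
  rewrite /nullproj scalerBr [RHS]scalerDr addrA.
  rewrite -[X in X + t *: 1%:M]scale1r -scalerDl; congr (_ + _).
  rewrite -!scalemxAl scalerA mulrN mulrCA mulfV// mulr1 scaleNr.
  by rewrite mulmxA.
rewrite detZ det_1mul_comm -scalemxAr -mulmxA mulVmx//.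
have -> : 1%:M + - (t / (1 + t)) *: 1%:M = (1 + t)^-1 *: 1%:M :> 'M[C]_m.
  rewrite -[X in X + _ *: _]scale1r -scalerDl; congr (_ *: _).
  apply: (mulfI t1).
  by rewrite mulfV// mulrDr mulr1 mulrN mulrCA mulfV// mulr1 addrK.
by rewrite detZ det1 mulr1 exprVn.
Qed.

End NullProj.

End Positive.
End Determinants.

(** * Gram determinants of lists of rows *)

Section GramOfRows.
Context (R : realType) (M : nat).
Local Notation C := R[i].
Implicit Types (l : seq 'rV[C]_M) (a : 'rV[C]_M).

(** The number of rows is a separate argument, so that dimensions such as [n1 + n2] need no cast
    from [size]. *)
Definition rows_mx n l : 'M[C]_(n, M) := \matrix_(i < n) nth 0 l i.

Definition gram l : C :=
  \det (rows_mx (size l) l *m hadj (rows_mx (size l) l)).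

Lemma rows_mx_cat n1 n2 l1 l2 : size l1 = n1 ->
  rows_mx (n1 + n2) (l1 ++ l2) = col_mx (rows_mx n1 l1) (rows_mx n2 l2).
Proof.
move=> s1; apply/row_matrixP => i; rewrite rowK nth_cat s1.
case: (split_ordP i) => j ->; first by rewrite rowKu rowK.
by rewrite rowKd rowK /= addKn.
Qed.

Lemma gramE n l : size l = n -> gram l = \det (rows_mx n l *m hadj (rows_mx n l)).
Proof. by move=> <-. Qed.

Lemma gram_unit l : 0 < gram l ->
  rows_mx (size l) l *m hadj (rows_mx (size l) l) \in unitmx.
Proof. by move=> h; rewrite unitmxE unitfE gt_eqF. Qed.

Lemma gram_cat n2 l1 l2 : size l2 = n2 -> 0 < gram l1 ->
  gram (l1 ++ l2) = gram l1 * \det (rows_mx n2 l2 *m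
    nullproj (rows_mx (size l1) l1) *m hadj (rows_mx n2 l2)).
Proof.
move=> s2 g1; rewrite (@gramE (size l1 + n2)) ?size_cat ?s2//.
by rewrite rows_mx_cat// det_gram_col_mx// gram_unit.
Qed.

Lemma gram_rcons l a : 0 < gram l ->
  gram (rcons l a) =
  gram l * (a *m nullproj (rows_mx (size l) l) *m hadj a) 0 0.
Proof.
move=> g; rewrite -cats1 (@gram_cat 1)//.
have -> : rows_mx 1 [:: a] = a by apply/row_matrixP => i; rewrite ord1 rowK row_id.
by rewrite det_mx11.
Qed.

(** The permutation matrix enters twice, so its sign squares to 1. This permits moving a block of
    rows to the end of the list. *)
Lemma gram_perm l1 l2 : perm_eq l1 l2 -> gram l1 = gram l2.
Proof.
move=> /[dup] /perm_size s12; rewrite perm_sym => /(perm_iotaP 0)[p pp El].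
have {}pp : perm_eq p (iota 0 (size l1)) by exact: pp.
have sp : size p = size l1 by rewrite (perm_size pp) size_iota.
have pP (i : 'I_(size l1)) : (nth 0%N p i < size l1)%N.
  have : nth 0%N p i \in p by rewrite mem_nth// sp.
  by rewrite (perm_mem pp) mem_iota.
pose f i : 'I_(size l1) := Ordinal (pP i).
have f_inj : injective f.
  move=> i j [] /eqP; rewrite nth_uniq ?sp// ?(perm_uniq pp) ?iota_uniq//.
  by move=> /eqP/val_inj.
rewrite (@gramE (size l1) l2)// /gram.
have -> : rows_mx (size l1) l2 = perm_mx (perm f_inj) *m rows_mx (size l1) l1.
  apply/matrixP => i j; rewrite -row_permE !mxE El permE.
  by rewrite (nth_map 0%N)// sp.
rewrite hadjM !mulmxA -(mulmxA _ (rows_mx _ _)) !det_mulmx det_hadj det_perm.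
by rewrite rmorph_sign mulrAC -expr2 sqrr_sign mul1r.
Qed.

(** The first projection annihilates the adjoint of every row of [l1], hence of [l2], which kills
    the correction term of the second. *)
Lemma nullproj_rows_subset l1 l2 : 0 < gram l1 -> {subset l2 <= l1} ->
  nullproj (rows_mx (size l1) l1) *m nullproj (rows_mx (size l2) l2) =
  nullproj (rows_mx (size l1) l1).
Proof.
move=> g1 l21; set P := nullproj (rows_mx (size l1) l1).
have P2 : P *m hadj (rows_mx (size l2) l2) = 0.
  apply/matrixP => x i; rewrite mxE [RHS]mxE.
  have /(nthP 0)[j js Ej] : nth 0 l2 i \in l1 by rewrite l21// mem_nth.
  have := nullproj_mul (gram_unit g1) => /matrixP/(_ x (Ordinal js)).
  rewrite mxE [RHS]mxE => h; rewrite -[RHS]h; apply: eq_bigr => y _.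
  by rewrite !hadjE !mxE Ej.
by rewrite {1}/nullproj mulmxBr mulmx1 !mulmxA P2 !mul0mx subr0.
Qed.

End GramOfRows.

Section RowSelection.
Context (R : realType) (M N : nat).
Local Notation C := R[i].
Implicit Types (l : seq 'rV[C]_M) (a : 'rV[C]_M).

(** Blocks are told apart by position, so the definition also makes sense for a list whose last
    block is incomplete. *)
Definition other_rows (k : nat) l : seq 'rV[C]_M :=
  [seq nth 0 l i | i <- iota 0 (size l) & (i %/ N != k)%N].

Lemma other_rows_rcons k l a : other_rows k (rcons l a) =
  if (size l %/ N != k)%N then rcons (other_rows k l) a else other_rows k l.
Proof.
rewrite /other_rows size_rcons -(addn1 (size l)) iotaD filter_cat map_cat /= add0n.
have -> : [seq nth 0 (rcons l a) i | i <- iota 0 (size l) & (i %/ N != k)%N] =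
    [seq nth 0 l i | i <- iota 0 (size l) & (i %/ N != k)%N].
  apply/eq_in_map => i; rewrite mem_filter mem_iota add0n => /andP[_ /= il].
  by rewrite nth_rcons il.
case: ifP => _ /=; last by rewrite cats0.
by rewrite nth_rcons ltnn eqxx cats1.
Qed.

Lemma other_rows_subset k l : {subset other_rows k l <= l}.
Proof.
apply/allP; rewrite all_map; apply/allP => i.
by rewrite mem_filter mem_iota add0n => /andP[_ /= il]; exact: mem_nth.
Qed.

Lemma size_other_rows k l : (0 < N)%N -> (k.+1 * N <= size l)%N ->
  size (other_rows k l) = (size l - N)%N.
Proof.
move=> N0 kl; rewrite size_map size_filter.
(* Positions before, inside and after block [k]; the filter is constant on each range. *)
have E : size l = (k * N + (N + (size l - k.+1 * N)))%N by lia.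
rewrite {1}E !iotaD !count_cat add0n.
have all_count (a : pred nat) s (b : bool) : {in s, forall i, a i = b} ->
    count a s = (b * size s)%N.
  by move=> h; rewrite (eq_in_count (a2 := fun=> b))//; case: b {h};
    rewrite ?count_predT ?count_pred0 ?mul1n.
rewrite (all_count _ _ true); last first.
  by move=> i; rewrite mem_iota add0n /= => ik; rewrite ltn_eqF// ltn_divLR.
rewrite (all_count _ (iota (k * N) N) false); last first.
  move=> i; rewrite mem_iota => /andP[ki ik]; apply/negbTE; rewrite negbK.
  by rewrite eqn_leq -ltnS ltn_divLR// leq_divRL// ki mulSn addnC ik.
rewrite (all_count _ _ true); last first.
  move=> i; rewrite mem_iota => /andP[ki ik]; rewrite gtn_eqF//.
  by rewrite leq_divRL// mulSn addnC.
by rewrite !size_iota; lia.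
Qed.

Lemma other_rows_id k l : (0 < N)%N -> (size l <= k * N)%N -> other_rows k l = l.
Proof.
move=> N0 lk; rewrite /other_rows (eq_in_filter (a2 := predT)); last first.
  move=> i; rewrite mem_iota add0n /= => il.
  by rewrite ltn_eqF// ltn_divLR// (leq_trans il).
by rewrite filter_predT map_nth_iota0// take_size.
Qed.

End RowSelection.

(** * Gaussian quadratic forms *)

Section GaussianQuadraticForm.
Context (R : realType).
Local Notation C := R[i].
Local Notation mu := (@lebesgue_measure R).
Local Notation Re := (@complex.Re R).
Local Notation Im := (@complex.Im R).

Definition complex_measurable (f : R -> C) : Prop :=
  measurable_fun setT (fun t => Re (f t)) /\
  measurable_fun setT (fun t => Im (f t)).

Lemma complex_measurableD f g : complex_measurable f -> complex_measurable g ->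
  complex_measurable (fun t => f t + g t).
Proof.
move=> [f1 f2] [g1 g2]; split.
  by under eq_fun do rewrite ReD; exact: measurable_funD.
by under eq_fun do rewrite ImD; exact: measurable_funD.
Qed.

Lemma complex_measurableM f g : complex_measurable f -> complex_measurable g ->
  complex_measurable (fun t => f t * g t).
Proof.
move=> [f1 f2] [g1 g2]; split.
  under eq_fun do rewrite ReM.
  by apply: measurable_funB; exact: measurable_funM.
under eq_fun do rewrite ImM.
by apply: measurable_funD; exact: measurable_funM.
Qed.

Lemma complex_measurable_real (f : R -> R) : measurable_fun setT f ->
  complex_measurable (fun t => (f t)%:C%C).
Proof. by move=> mf; split. Qed.

Lemma complex_measurable_cst (c : C) : complex_measurable (fun=> c).
Proof. by split. Qed.

Lemma complex_measurable_conj f : complex_measurable f ->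
  complex_measurable (fun t => (f t)^*).
Proof.
move=> [f1 f2]; split.
  by rewrite (_ : (fun t => _) = (fun t => Re (f t)))//; apply/funext => t; case: (f t).
rewrite (_ : (fun t => _) = (fun t => - Im (f t))); first exact: measurable_funN.
by apply/funext => t; case: (f t).
Qed.

Lemma complex_measurable_sum I (r : seq I) (f : I -> R -> C) :
  (forall i, complex_measurable (f i)) ->
  complex_measurable (fun t => \sum_(i <- r) f i t).
Proof.
move=> mf; elim: r => [|i r IH].
  by under eq_fun do rewrite big_nil; exact: complex_measurable_cst.
by under eq_fun do rewrite big_cons; exact: complex_measurableD.
Qed.

(** Strictness keeps the corner entry positive, hence invertible, at each elimination. *)
Definition posdef n (Q : 'M[C]_n) : Prop :=
  hadj Q = Q /\ forall u : 'rV[C]_n, u != 0 -> 0 < (u *m Q *m hadj u) 0 0.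

Definition crow_of_seq n (s : seq R) : 'rV[C]_n :=
  \row_(j < n) Complex (nth 0 s (2 * j)) (nth 0 s (2 * j).+1).

Lemma crow_of_seq_cat2 n (s : seq R) x y : size s = (2 * n)%N ->
  crow_of_seq (n + 1) (s ++ [:: x; y]) = row_mx (crow_of_seq n s) (Complex x y)%:M.
Proof.
move=> sn; apply/rowP => j; rewrite !mxE; case: splitP => k jk.
  rewrite !mxE jk !nth_cat sn ltn_mul2l/= ltn_ord.
  by rewrite (_ : ((2 * k).+1 < 2 * n)%N)//; have := ltn_ord k; lia.
rewrite !mxE jk ord1 !nth_cat sn addn0 ltnn subnn ltnNge leqnSn/=.
by rewrite subSnn mulr1n.
Qed.

Lemma mulmx_hadj_row n (a : 'rV[C]_n) (z : C) :
  (row_mx a z%:M *m hadj (row_mx a z%:M)) 0 0 = (a *m hadj a) 0 0 + z * z^*.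
Proof.
rewrite hadj_row_mx mul_row_col hadj_scalar mul_scalar_mx [LHS]mxE.
by rewrite [X in _ + X = _]mxE [X in _ + _ * X = _]mxE eqxx mulr1n.
Qed.

(* Integrating out the last complex coordinate replaces the quadratic form by
   its Schur complement. *)
Section SchurStep.
Variables (n : nat) (A : 'M[C]_n) (b : 'M[C]_(n, 1)) (s : R).
Let Q : 'M[C]_(n + 1) := block_mx A b (hadj b) (s%:C%C)%:M.

Lemma quad_block_row (a : 'rV[C]_n) (z : C) :
  (row_mx a z%:M *m Q *m hadj (row_mx a z%:M)) 0 0 =
  (a *m A *m hadj a) 0 0 + (z * ((a *m b) 0 0)^* + (a *m b) 0 0 * z^*) +
    s%:C%C * (z * z^*).
Proof.
rewrite /Q mul_row_block hadj_row_mx mul_row_col !mulmxDl.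
rewrite hadj_scalar !mul_scalar_mx -scalemxAl -hadjM !mul_mx_scalar.
have addE (X Y : 'M[C]_1) : (X + Y) 0 0 = X 0 0 + Y 0 0 by rewrite mxE.
have scaleE c (X : 'M[C]_1) : (c *: X) 0 0 = c * X 0 0 by rewrite mxE.
rewrite !addE !scaleE hadjE.
rewrite (_ : (s%:C%C)%:M 0 0 = s%:C%C); last by rewrite mxE eqxx mulr1n.
by ring.
Qed.

Lemma quad_schur (u : 'rV[C]_n) (c : C) :
  (u *m (A - c *: (b *m hadj b)) *m hadj u) 0 0 =
  (u *m A *m hadj u) 0 0 - c * ((u *m b) 0 0 * ((u *m b) 0 0)^*).
Proof.
rewrite mulmxBr mulmxBl -scalemxAr -scalemxAl (mulmxA u b) -(mulmxA (u *m b)).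
rewrite -hadjM [LHS]mxE; congr (_ + _); rewrite mxE [X in - X]mxE.
by congr (- (_ * _)); rewrite mxE big_ord1 hadjE.
Qed.

Lemma posdef_corner : posdef Q -> 0 < s.
Proof.
move=> [_ /(_ (row_mx 0 1%:M))]; rewrite quad_block_row !mul0mx !mxE.
rewrite conjC0 mulr0 mul0r conjC1 !mulr1 !add0r => h.
suff /h : row_mx (0 : 'rV[C]_n) 1%:M != 0 by rewrite -(ltcR 0).
rewrite row_mx_eq0 negb_and orbC; apply/orP; left.
by apply/eqP => /matrixP/(_ 0 0)/eqP; rewrite !mxE eqxx oner_eq0.
Qed.

Lemma posdef_schur : posdef Q ->
  posdef (A - (s^-1)%:C%C *: (b *m hadj b)).
Proof.
move=> pQ; have s0 := posdef_corner pQ; case: pQ => hQ pQ; split.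
  have hA : hadj A = A.
    have := hQ; rewrite /Q /hadj map_block_mx tr_block_mx.
    by move/eq_block_mx => [].
  rewrite hadjD hadjN hadjZ hadjM hadjK hA.
  by rewrite (_ : ((s^-1)%:C%C)^* = (s^-1)%:C%C)//; exact: conjc_real.
move=> u u0; set w := (u *m b) 0 0.
(* This last coordinate minimizes the form of [Q] for fixed [u]; the minimum is the Schur complement
   at [u]. *)
have := pQ (row_mx u (- ((s^-1)%:C%C * w))%:M).
rewrite row_mx_eq0 (negbTE u0) => /(_ isT).
rewrite quad_block_row -/w quad_schur -/w.
have -> : (- ((s^-1)%:C%C * w))^* = - ((s^-1)%:C%C * w^*).
  by rewrite rmorphN rmorphM; congr (- (_ * _)); exact: conjc_real.
congr (_ < _); rewrite -addrA; congr (_ + _).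
have ss : s%:C%C * (s^-1)%:C%C = 1 by rewrite -rmorphM/= mulfV ?rmorph1// gt_eqF.
rewrite mulrNN [X in _ + X = _](_ : _ = (s%:C%C * (s^-1)%:C%C) * ((s^-1)%:C%C * (w * w^*))).
  by rewrite ss; ring.
by ring.
Qed.

Lemma det_posdef_schur : 0 < s ->
  \det Q = s%:C%C * \det (A - (s^-1)%:C%C *: (b *m hadj b)).
Proof.
move=> s0; have sC : s%:C%C != 0 :> C by rewrite gt_eqF// ltcR.
rewrite /Q det_schur_dr; last by rewrite unitmxE det_scalar1 unitfE.
rewrite det_scalar1 invmx_scalar mul_mx_scalar -scalemxAl.
by rewrite fmorphV.
Qed.

End SchurStep.

(** The matrices [1 + t P] are not stable under Schur complements, so the induction runs over all
    positive definite families. The term [a a^H] in the exponent cancels the Gaussian weight. *)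
Lemma gauss_pmean_quad n (S : R -> 'M[C]_n) :
  (forall t, posdef (S t)) ->
  (forall i j, complex_measurable (fun t => S t i j)) ->
  gauss_pmean (2 * n)
    (fun t l => expR (Re ((crow_of_seq n l *m hadj (crow_of_seq n l)) 0 0
        - (crow_of_seq n l *m S t *m hadj (crow_of_seq n l)) 0 0)))
    (fun t => (Re (\det (S t)))^-1).
Proof.
elim: n S => [|n IH].
  by move=> S _ _ t; rewrite det_mx00 /= invr1 !mxE !big_ord0 subrr expR0.
rewrite -addn1 mulnDr muln1 => S pS mS.
pose A t := ulsubmx (S t); pose b t := ursubmx (S t).
pose s t := Re (S t (rshift n 0) (rshift n 0)).
have SE t : S t = block_mx (A t) (b t) (hadj (b t)) ((s t)%:C%C)%:M.
  rewrite -[LHS]submxK; congr block_mx.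
    by rewrite -{1}(pS t).1; apply/matrixP => i j; rewrite !mxE.
  apply/matrixP => i j; rewrite !ord1 !mxE eqxx mulr1n /s.
  have : (S t (rshift n 0) (rshift n 0))^* = S t (rshift n 0) (rshift n 0).
    by rewrite -{2}(pS t).1 hadjE.
  by case: (S t _ _) => x y [] /eqP; rewrite eq_sym -addr_eq0 -mulr2n mulrn_eq0/= => /eqP ->.
have pS' t : posdef (block_mx (A t) (b t) (hadj (b t)) ((s t)%:C%C)%:M).
  by rewrite -SE.
have s0 t : 0 < s t by exact: posdef_corner (pS' t).
have ms : measurable_fun setT s by exact: (mS _ _).1.
have msV := measurable_fun_inv_pos s0 ms.
pose S' t := A t - ((s t)^-1)%:C%C *: (b t *m hadj (b t)).
pose g t l := (s t)^-1 * expR (Re ((crow_of_seq n l *m hadj (crow_of_seq n l)) 0 0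
        - (crow_of_seq n l *m S' t *m hadj (crow_of_seq n l)) 0 0)).
have mA i j : complex_measurable (fun t => A t i j).
  by under eq_fun do rewrite !mxE; exact: mS.
have mb i : complex_measurable (fun t => b t i 0).
  by under eq_fun do rewrite !mxE; exact: mS.
apply: (@gauss_pmean_cat R (2 * n) 2 _ g).
  rewrite (_ : (fun t => (Re (\det (S t)))^-1) =
      fun t => (s t)^-1 * (Re (\det (S' t)))^-1).
    apply: gauss_pmeanZ => //; apply: IH.
      by move=> t; exact: posdef_schur.
    move=> i j; rewrite /S'; under eq_fun do rewrite !mxE big_ord1 hadjE -mulN1r.
    apply: complex_measurableD => //; apply: complex_measurableM.
      exact: complex_measurable_cst.
    apply: complex_measurableM; first exact: complex_measurable_real.
    by apply: complex_measurableM => //; exact: complex_measurable_conj.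
  apply/funext => t; rewrite SE det_posdef_schur// ReCM invfM//.
move=> l sl; set a := crow_of_seq n l.
pose w t := (a *m b t) 0 0.
have [mw1 mw2] : complex_measurable w.
  rewrite /w; under eq_fun do rewrite mxE.
  by apply: complex_measurable_sum => i; apply: complex_measurableM.
have [mc _] : complex_measurable (fun t => (a *m A t *m hadj a) 0 0).
  under eq_fun do rewrite mxE.
  apply: complex_measurable_sum => i; apply: complex_measurableM => //.
  under eq_fun do rewrite mxE.
  by apply: complex_measurable_sum => j; apply: complex_measurableM.
(* The cross terms [z w^* + w z^*] equal [2 (Re w x + Im w y)] for [z = x + i y], so [Re w] and
   [Im w] are the linear coefficients of the square. *)
rewrite (_ : (fun t => g t l) = fun t => (s t)^-1 * expR ((Re (w t) ^+ 2 + Im (w t) ^+ 2) / s t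
   - (Re ((a *m A t *m hadj a) 0 0) - Re ((a *m hadj a) 0 0)))).
  apply: gauss_pmean_square2 => //; first exact: measurable_funB.
  move=> t x y; rewrite crow_of_seq_cat2// -/a SE quad_block_row -/(w t).
  rewrite mulmx_hadj_row.
  rewrite !(ReB, ReD).
  rewrite ReCM; case: (w t) => w1 w2 /=; congr expR.

  by ring.
apply/funext => t; rewrite /g -/a /S' quad_schur -/(w t); congr (_ * expR _).
rewrite !ReB.
rewrite ReCM; case: (w t) => w1 w2 /=.
by field; rewrite (gt_eqF (s0 t)).
Qed.

End GaussianQuadraticForm.

(** * Logarithms of nested Gaussian quadratic forms *)

Section LogRatio.
Context (R : realType).
Local Notation C := R[i].
Local Notation mu := (@lebesgue_measure R).
Local Notation Re := (@complex.Re R).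

Lemma ae_neq (y0 : R) : {ae mu, forall y, y != y0}.
Proof.
exists [set y0]; split; [exact: measurable_set1|exact: lebesgue_measure_set1|].
by move=> y /= /negP; rewrite negbK => /eqP.
Qed.

(** If the last coefficient is nonzero, then for fixed other coordinates and fixed real part at most
    one imaginary part gives a zero. Otherwise the last coordinate drops out. *)
Lemma gauss_ae_linear n (v : 'cV[C]_n) (c : C) : v != 0 ->
  gauss_ae (2 * n) (fun s : seq R => (crow_of_seq n s *m v) 0 0 + c != 0).
Proof.
elim: n v c => [|n IH] v c; first by rewrite [v]flatmx0 eqxx.
move: v; rewrite -addn1 mulnDr muln1 => v v0; apply: gauss_ae_cat.
have vE : v = col_mx (usubmx v) (dsubmx v 0 0)%:M.
  by rewrite -[LHS]vsubmxK; congr col_mx; apply/matrixP => i j; rewrite !ord1 !mxE eqxx mulr1n.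
have E l x y : size l = (2 * n)%N -> (crow_of_seq (n + 1) (l ++ [:: x; y]) *m v) 0 0 =
    (crow_of_seq n l *m usubmx v) 0 0 + Complex x y * dsubmx v 0 0.
  move=> sl; rewrite crow_of_seq_cat2// {1}vE mul_row_col mul_scalar_mx.
  by rewrite [LHS]mxE; congr (_ + _); rewrite mxE [X in _ * X]mxE eqxx mulr1n.
have [w0|w0] := eqVneq (dsubmx v 0 0) 0.
  have u0 : usubmx v != 0.
    by apply: contra_neq v0 => u0; rewrite vE u0 w0 raddf0 col_mx0.
  apply: gauss_ae_impl (IH _ c u0) => l sl h.
  by apply: gauss_ae_all => -[|x [|y [|]]]//= _; rewrite E// w0 mulr0 addr0.
apply: gauss_ae_all => l sl /=; apply: aeW => x.
set d := (crow_of_seq n l *m usubmx v) 0 0.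
have := ae_neq (complex.Im (- (d + c) / dsubmx v 0 0)).
apply: filterS => y; apply: contra_neq => h; rewrite E// -/d in h.
have -> : - (d + c) / dsubmx v 0 0 = Complex x y; last by [].
apply: (mulIf w0); rewrite divfK//.
by apply/eqP; rewrite eq_sym -addr_eq0; apply/eqP; rewrite -[RHS]h; ring.
Qed.

Section Ratio.
Variables (n m : nat) (A : 'M[C]_(m, n)).
Hypothesis uA : A *m hadj A \in unitmx.

Definition quad (P : 'M[C]_n) (s : seq R) : C :=
  (crow_of_seq n s *m P *m hadj (crow_of_seq n s)) 0 0.

Lemma quad_nullproj_ge0 s : 0 <= quad (nullproj A) s.
Proof. by have /psd_rowP[_] := psd_nullproj uA; apply. Qed.

(** The form is the squared norm of [a P], and a nonzero column of [P] makes an entry of [a P]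
    nonzero almost surely. *)
Lemma gauss_ae_quad_gt0 : (m < n)%N ->
  gauss_ae (2 * n) (fun s => 0 < quad (nullproj A) s).
Proof.
move=> mn; set P := nullproj A.
have P0 : P != 0.
  (* At [t = 1] the determinant is [2^(n - m)], which would be 1 if the projection vanished. *)
  apply/eqP => P0; have := @det_1Dnullproj R m n A uA 1.
  rewrite -/P P0 scaler0 addr0 det1 (_ : 1 + 1 = 2%:R)// pnatr_eq0 => /(_ isT)/eqP.
  rewrite eq_sym -expfB// -natrX pnatr_eq1 -[1%N](expn0 2) eqn_exp2l// subn_eq0.
  by rewrite leqNgt mn.
have [j Pj] : exists j, col j P != 0.
  apply/existsP; apply: contraT; rewrite negb_exists => /forallP h.
  case/eqP: P0; apply/matrixP => i j; have := h j; rewrite negbK => /eqP/colP/(_ i).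
  by rewrite !mxE.
apply: gauss_ae_impl (gauss_ae_linear 0 Pj) => s sn; rewrite addr0 => h.
rewrite lt_def quad_nullproj_ge0 andbT; apply: contra_neq h => q0.
have : crow_of_seq n s *m P = 0.
  apply/eqP; rewrite -mulmx_hadj_eq0 hadjM hadj_nullproj mulmxA -(mulmxA _ P P).
  by rewrite nullproj_idem//; apply/eqP.
by move=> aP; rewrite colE mulmxA aP mul0mx mxE.
Qed.

(** [Num.max t 0] keeps the matrix positive definite for every real [t], as [gauss_pmean_quad]
    demands; the values at [t <= 0] are later multiplied by [pos_inv t = 0]. *)
Let S (t : R) : 'M[C]_n := 1%:M + (Num.max t 0)%:C%C *: nullproj A.

Lemma gauss_pmean_exp_quad : (m <= n)%N ->
  gauss_pmean (2 * n) (fun t s => expR (- (Num.max t 0 * Re (quad (nullproj A) s))))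
    (fun t => (1 + Num.max t 0)^-1 ^+ (n - m)).
Proof.
move=> mn.
have t0 (t : R) : 0 <= Num.max t 0 by rewrite le_max lexx orbT.
have tC (t : R) : 0 <= (Num.max t 0)%:C%C by rewrite ler0c.
have pS t : posdef (S t).
  have [hS _] : psd (S t) by apply: psdD; [exact: psd1|apply: psdZ; [|exact: psd_nullproj]].
  split=> // u u0; rewrite mulmxDr mulmx1 mulmxDl -scalemxAr -scalemxAl.
  rewrite [ltRHS]mxE [X in _ + X]mxE ltr_wpDr//.
    by apply: mulr_ge0 => //; have /psd_rowP[_] := psd_nullproj uA; apply.
  by rewrite lt_def mulmx_hadj_eq0 u0 mulmx_hadj_ge0.
have mmax : measurable_fun setT (fun t : R => Num.max t 0) by exact: measurable_maxr.
have mS i j : complex_measurable (fun t => S t i j).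
  rewrite /S; under eq_fun do rewrite !mxE.
  apply: complex_measurableD; first exact: complex_measurable_cst.
  apply: complex_measurableM; last exact: complex_measurable_cst.
  exact: complex_measurable_real.
have := gauss_pmean_quad pS mS.
rewrite (_ : (fun t => (Re (\det (S t)))^-1) = (fun t => (1 + Num.max t 0)^-1 ^+ (n - m))).
  rewrite (_ : (fun t l => expR _) =
    fun t s => expR (- (Num.max t 0 * Re (quad (nullproj A) s))))//.
  apply/funext => t; apply/funext => l; congr expR.
  rewrite /S mulmxDr mulmx1 mulmxDl -scalemxAr -scalemxAl.
  rewrite [X in _ - X]mxE [X in _ - (_ + X)]mxE opprD addrA subrr sub0r -/(quad _ _).
  by rewrite -ReCM; case: (_ * _).
apply/funext => t; rewrite /S det_1Dnullproj//; last first.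
  by rewrite gt_eqF// ltr_pwDl// ltr01.
rewrite -expfB_cond; last first.
  by rewrite (gt_eqF _) ?add0n// ltr_pwDl// ltr01.
rewrite exprVn; congr (_^-1).
by rewrite -[1 in LHS](rmorph1 (real_complex R)) -rmorphD/= -rmorphXn.
Qed.

End Ratio.

Section NestedRatio.
Variables (n m m' : nat) (A : 'M[C]_(m, n)) (B : 'M[C]_(m', n)).
Hypotheses (uA : A *m hadj A \in unitmx) (uB : B *m hadj B \in unitmx).
Hypothesis AB : nullproj A *m nullproj B = nullproj A.

(** The difference of nested orthogonal projections is again one, so it equals its own Gram
    matrix. *)
Lemma quad_nullproj_le s : quad (nullproj A) s <= quad (nullproj B) s.
Proof.
have BA : nullproj B *m nullproj A = nullproj A.
  by rewrite -[LHS]hadjK hadjM !hadj_nullproj AB hadj_nullproj.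
set D := nullproj B - nullproj A.
have DD : D *m hadj D = D.
  rewrite /D hadjD hadjN !hadj_nullproj mulmxBr !(mulmxBl (nullproj B)).
  by rewrite !nullproj_idem// AB BA subrr subr0.
have /psd_rowP[_ /(_ (crow_of_seq n s))] := psd_gram D.
rewrite DD /D (mulmxBr _ (nullproj B)) (mulmxBl (_ *m nullproj B)).
by rewrite mxE [X in _ + X]mxE subr_ge0.
Qed.

Lemma gauss_mean_ln_ratio : (m' <= m)%N -> (m < n)%N ->
  gauss_mean (2 * n) (fun s => ln (Re (quad (nullproj B) s))
     - ln (Re (quad (nullproj A) s)))
   (\sum_(n - m <= j < n - m') j%:R^-1).
Proof.
move=> m'm mn.
have qle s : 0 <= Re (quad (nullproj A) s) <= Re (quad (nullproj B) s).
  have := quad_nullproj_le s; have := quad_nullproj_ge0 uA s.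
  by rewrite !lecE => /andP[_ ->] /andP[_ ->].
pose f (t : R) s := pos_inv t * (expR (- (Num.max t 0 * Re (quad (nullproj A) s)))
  - expR (- (Num.max t 0 * Re (quad (nullproj B) s)))).
have f0 t s : size s = (2 * n)%N -> 0 <= f t s.
  move=> _; have /andP[_ h] := qle s.
  rewrite mulr_ge0 ?pos_inv_ge0// subr_ge0 ler_expR lerN2 ler_wpM2l//.
  by rewrite le_max lexx orbT.
have pf : gauss_pmean (2 * n) f (fun t => pos_inv t *
    ((1 + Num.max t 0)^-1 ^+ (n - m) - (1 + Num.max t 0)^-1 ^+ (n - m'))).
  apply: gauss_pmeanZ; first exact: measurable_pos_inv.
  apply: gauss_pmeanB; apply: gauss_pmean_exp_quad => //; first exact: ltnW.
  by rewrite (leq_trans m'm)// ltnW.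
have nm0 : (0 < n - m)%N by rewrite subn_gt0.
have [ci <-] := integrable_pos_inv_pow R nm0 (leq_sub2l n m'm).
apply: gauss_mean_ae (gauss_pmean_mean f0 pf ci).
(* Frullani's formula needs the smaller form to be positive, which holds almost everywhere. *)
apply: gauss_ae_impl (gauss_ae_quad_gt0 uA mn) => s _ q0.
rewrite -frullani_expR; last by have /andP[] := qle s.
  apply: eq_Rintegral => t _; rewrite /f.
  by have [t0|t0] := ltP 0 t; rewrite ?(pos_inv0 t0) ?mul0r.
by move: q0; rewrite ltcE => /andP[].
Qed.

End NestedRatio.
End LogRatio.

(** * Expected gain, row by row *)

Section HarmonicSum.
Context (F : fieldType) (N M : nat).

Lemma big_nat_mul_block (K : nat) (f : nat -> F) :
  \sum_(0 <= r < K.+1 * N) f r =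
  \sum_(0 <= r < K * N) f r + \sum_(n < N) f (K * N + n)%N.
Proof.
rewrite (@big_cat_nat _ _ _ (K * N))//=; last by rewrite leq_mul2r leqnSn orbT.
congr (_ + _); rewrite -{1}[(K * N)%N]add0n big_addn mulSn addnK big_mkord.
by apply: eq_bigr => i _; rewrite addnC.
Qed.

(** The substitution [j = M - n - i], which reverses the range. *)
Lemma harmonic_block (K n : nat) : (n < N)%N -> (K.+2 * N <= M)%N ->
  \sum_(M - (K.+1 * N + n) <= j < M - (K.+1 * N + n) + N) (j%:R^-1 : F) =
  \sum_(K * N + 1 <= i < K.+1 * N + 1) (M - n - i)%:R^-1.
Proof.
move=> nN KM; set a := (M - _)%N.
have aE : (M = a + (K.+1 * N + n))%N.
  by rewrite /a subnK//; move: KM nN; rewrite (mulSn K.+1); lia.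
rewrite -{1}[a]add0n big_addn addKn big_mkord.
rewrite -{1}[(K * N + 1)%N]add0n big_addn.
rewrite (_ : K.+1 * N + 1 - (K * N + 1) = N)%N; last by rewrite mulSn; lia.
rewrite big_mkord (reindex_inj rev_ord_inj); apply: eq_bigr => i _ /=.
congr (_%:R^-1); rewrite aE mulSn; have := ltn_ord i; lia.
Qed.

(** Row [r = K N + n] of a new block adds, for each [k < K], the slice [(K - 1) N < i <= K N], which
    extends the inner range already present for [k] and [n]. The new outer index [k = K] has an
    empty range. *)
Lemma sum_harmonic_blocks (K : nat) : (0 < N)%N -> (K * N <= M)%N ->
  \sum_(0 <= r < K * N) \sum_(k < (r %/ N)%N)
     \sum_(M - r <= j < M - r + N) (j%:R^-1 : F) =
  \sum_(k < K) \sum_(n < N) \sum_(k * N + 1 <= i < (K - 1) * N + 1)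
     (M - n - i)%:R^-1.
Proof.
move=> N0; elim: K => [|K IH] KM; first by rewrite mul0n big_geq// big_ord0.
rewrite big_nat_mul_block IH; last by apply: leq_trans KM; rewrite leq_mul2r leqnSn orbT.
rewrite big_ord_recr/= subSS subn0 [X in _ = _ + X]big1 ?addr0; last first.
  by move=> n _; rewrite big_geq.
under [X in _ + X]eq_bigr => n _.
  rewrite divnMDl// divn_small// addn0.
  over.
rewrite [X in _ + X]exchange_big/= -big_split/=; apply: eq_bigr => k _.
rewrite -big_split/=; apply: eq_bigr => n _.
case: K KM {IH} k => [|K] KM k; first by case: k.
rewrite harmonic_block// subSS subn0 -big_cat_nat//=.
- by rewrite leq_add2r leq_mul2r -ltnS ltn_ord orbT.
- by rewrite leq_add2r leq_mul2r leqnSn orbT.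
Qed.

End HarmonicSum.

(** * Growth of the log gain under appended rows *)

Section RowRecursion.
Context (R : realType) (K N M : nat).
Local Notation C := R[i].
Local Notation Re := (@complex.Re R).
Implicit Types (l : seq 'rV[C]_M) (a : 'rV[C]_M).

(** Positivity in [R[i]] includes being real, so [Re] is multiplicative on these determinants. *)
Definition generic_rows l : Prop :=
  0 < gram l /\ forall k, 0 < gram (other_rows N k l).

(* ln 2 times the high-SNR rate gap of the channel with rows [l]. *)
Definition log_gain l : R :=
  \sum_(k < K) ln (Re (gram (other_rows N k l))) - K.-1%:R * ln (Re (gram l)).

(** Mean increment of [log_gain] due to row [r]: one difference of logarithms for each of the
    [r %/ N] complete blocks. *)
Definition row_gain (r : nat) : R :=
  \sum_(k < (r %/ N)%N) \sum_(M - r <= j < M - r + N) j%:R^-1.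

Let proj l := nullproj (rows_mx (size l) l).

Lemma ReM_gt0 (x y : C) : 0 < x -> 0 < y -> Re (x * y) = Re x * Re y.
Proof.
move=> x0 y0; rewrite ReM !ger0_Im ?mulr0 ?subr0//; exact: ltW.
Qed.

Lemma Re_gt0 (x : C) : 0 < x -> 0 < Re x.
Proof. by rewrite ltcE => /andP[]. Qed.

Lemma ln_ReM (x y : C) : 0 < x -> 0 < y -> ln (Re (x * y)) = ln (Re x) + ln (Re y).
Proof. by move=> x0 y0; rewrite ReM_gt0// lnM ?posrE ?Re_gt0. Qed.

(** One inequality suffices: the projections for the sublists dominate the one for all rows. *)
Lemma generic_rows_rcons l s : generic_rows l ->
  0 < quad (proj l) s -> generic_rows (rcons l (crow_of_seq M s)).
Proof.
move=> [g h] q; split; first by rewrite gram_rcons// mulr_gt0.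
move=> k; rewrite other_rows_rcons; case: ifP => // _.
rewrite gram_rcons// mulr_gt0//; apply: lt_le_trans q _.
apply: quad_nullproj_le; [exact: gram_unit|exact: gram_unit|].
by apply: nullproj_rows_subset => //; exact: other_rows_subset.
Qed.

(** The new row enters [other_rows] for the [K - 1] indices other than its own block [b], and the
    [K - 1] copies of the full Gram logarithm pair off with them. *)
Lemma log_gain_rcons l s : (0 < N)%N -> generic_rows l -> (size l < K * N)%N ->
  0 < quad (proj l) s ->
  log_gain (rcons l (crow_of_seq M s)) =
  log_gain l + \sum_(k < K | k != (size l %/ N)%N :> nat)
    (ln (Re (quad (proj (other_rows N k l)) s)) - ln (Re (quad (proj l) s))).
Proof.
move=> N0 [g h] lK q; pose b : 'I_K := Ordinal (etrans (ltn_divLR _ _ N0) lK).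
have qk k : 0 < quad (proj (other_rows N k l)) s.
  apply: lt_le_trans q _.
  apply: quad_nullproj_le; [exact: gram_unit|exact: gram_unit|].
  by apply: nullproj_rows_subset => //; exact: other_rows_subset.
rewrite sumrB [X in _ + (_ - X)]sumr_const.
rewrite [X in _ *+ X](_ : _ = K.-1); last first.
  rewrite -[K in RHS]card_ord -(cardC1 b); apply: eq_card => k.
  by rewrite !inE -val_eqE.
have -> : \sum_(k < K | k != (size l %/ N)%N :> nat)
      ln (Re (quad (proj (other_rows N k l)) s)) =
    \sum_(k < K) ln (Re (gram (other_rows N k (rcons l (crow_of_seq M s))))) -
    \sum_(k < K) ln (Re (gram (other_rows N k l))).
  rewrite big_mkcond -sumrB; apply: eq_bigr => k _.
  rewrite other_rows_rcons eq_sym; case: ifP => _; last by rewrite subrr.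
  rewrite gram_rcons// ln_ReM//; last exact: qk.
  by rewrite [X in _ = X - _]addrC addrK.
rewrite /log_gain gram_rcons// ln_ReM// -[X in _ = _ + (_ - X)]mulr_natl.
by ring.
Qed.

Lemma gauss_mean_log_gain_rcons l : (0 < N)%N -> generic_rows l -> (size l < K * N)%N ->
  (K * N <= M)%N ->
  gauss_mean (2 * M) (fun s => log_gain (rcons l (crow_of_seq M s)))
    (log_gain l + row_gain (size l)).
Proof.
move=> N0 gl lK KM; have [g h] := gl; have lM := leq_trans lK KM.
have aeq := gauss_ae_quad_gt0 (gram_unit g) lM.
pose d k s := ln (Re (quad (proj (other_rows N k l)) s)) - ln (Re (quad (proj l) s)).
apply: (@gauss_mean_ae _ _ (fun s => log_gain l +
    \sum_(k < K | k != (size l %/ N)%N :> nat) d k s)).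
  by apply: gauss_ae_impl aeq => s _ q; rewrite log_gain_rcons.
have dk k : gauss_mean (2 * M) (d k)
    (\sum_(M - size l <= j < M - size (other_rows N k l)) j%:R^-1).
  apply: gauss_mean_ln_ratio => //; [exact: gram_unit|exact: gram_unit| |].
    by apply: nullproj_rows_subset => //; exact: other_rows_subset.
  by rewrite size_map size_filter (leq_trans (count_size _ _))// size_iota.
have -> : row_gain (size l) = \sum_(k < K | k != (size l %/ N)%N :> nat)
    \sum_(M - size l <= j < M - size (other_rows N k l)) j%:R^-1.
  (* Complete blocks lack [N] rows and give [N] terms each; for blocks not yet begun [other_rows] is
     all of [l] and the range is empty. *)
  rewrite (bigID (fun k : 'I_K => (k < size l %/ N)%N))/= [X in _ + X]big1 ?addr0.
    rewrite (eq_bigl (fun k : 'I_K => (k < size l %/ N)%N)); last first.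
      by move=> k /=; case: ltngtP.
    have bK : (size l %/ N <= K)%N by rewrite ltnW// ltn_divLR.
    rewrite /row_gain (big_ord_widen _ (fun k => \sum_(M - size l <= j < M - size l + N) j%:R^-1) bK).
    apply: eq_bigr => k kb; rewrite size_other_rows//; last by rewrite -leq_divRL.
    congr (\sum_(_ <= _ < _) _).
    have : (k.+1 * N <= size l)%N by rewrite -leq_divRL.
    by rewrite mulSn; lia.
  move=> k /andP[kb]; rewrite -leqNgt => bk.
  rewrite other_rows_id ?big_geq// ltnW// -ltn_divLR//.
  by rewrite ltn_neqAle eq_sym kb.
by apply: gauss_meanD; [exact: gauss_mean_cst|apply: gauss_mean_sum => k _].
Qed.

Definition rows_of_seq (r : nat) (s : seq R) : seq 'rV[C]_M :=
  [seq crow_of_seq M (drop (2 * M * i) s) | i <- iota 0 r].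

Lemma rows_of_seq_cat r s s' : size s = (2 * M * r)%N ->
  rows_of_seq r.+1 (s ++ s') = rcons (rows_of_seq r s) (crow_of_seq M s').
Proof.
move=> sr; rewrite /rows_of_seq -(addn1 r) iotaD map_cat /= add0n cats1.
rewrite drop_size_cat//; congr rcons; apply/eq_in_map => i.
rewrite mem_iota add0n /= => ir; apply/rowP => j; rewrite !mxE !nth_drop !nth_cat sr.
have b (c : nat) : (c < 2 * M)%N -> (2 * M * i + c < 2 * M * r)%N.
  have : (2 * M * i.+1 <= 2 * M * r)%N by rewrite leq_mul2l ir orbT.
  by rewrite mulnS; move: (2 * M * i)%N (2 * M * r)%N => x y; lia.
by rewrite !b//; have := ltn_ord j; lia.
Qed.

Lemma size_rows_of_seq r s : size (rows_of_seq r s) = r.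
Proof. by rewrite size_map size_iota. Qed.

Lemma generic_rows_nil : generic_rows [::].
Proof. by split; [|move=> k]; rewrite /gram det_mx00 ltr01. Qed.

Lemma gauss_ae_generic_rows r : (r <= M)%N ->
  gauss_ae (2 * M * r) (fun s => generic_rows (rows_of_seq r s)).
Proof.
elim: r => [|r IH] rM; first by rewrite muln0 /=; exact: generic_rows_nil.
rewrite mulnS addnC; apply: gauss_ae_cat.
apply: gauss_ae_impl (IH (ltnW rM)) => s sr gs.
have uA := gram_unit gs.1.
have rM' : (size (rows_of_seq r s) < M)%N by rewrite size_rows_of_seq.
apply: gauss_ae_impl (gauss_ae_quad_gt0 uA rM') => s' _ q.
rewrite rows_of_seq_cat//.
exact: generic_rows_rcons.
Qed.

(** Given generic earlier rows, the mean increment is a number that does not depend on them, so the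
    increments add up. *)
Lemma gauss_mean_log_gain r : (0 < N)%N -> (r <= K * N)%N -> (K * N <= M)%N ->
  gauss_mean (2 * M * r) (fun s => log_gain (rows_of_seq r s))
    (\sum_(0 <= i < r) row_gain i).
Proof.
move=> N0 rK KM; elim: r rK => [|r IH] rK.
  rewrite muln0 /= big_geq// /log_gain /gram big1.
    by rewrite det_mx00 /= ln1 mulr0 subrr.
  by move=> k _; rewrite det_mx00 ln1.
rewrite mulnS addnC big_nat_recr//=.
apply: gauss_mean_cat.
  by apply: gauss_meanD; [exact: IH (ltnW rK)|exact: gauss_mean_cst].
apply: gauss_ae_impl (gauss_ae_generic_rows _); last first.
  by rewrite (leq_trans (ltnW rK)).
move=> s sr gs; under eq_fun do rewrite rows_of_seq_cat//.
have := gauss_mean_log_gain_rcons N0 gs; rewrite size_rows_of_seq; exact.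
Qed.

End RowRecursion.

(** * High-SNR limits of the sum capacities *)

Section HighSNR.
Context (R : realType).
Local Notation C := R[i].
Local Notation Re := (@complex.Re R).

(** By [ln (1 + x) <= x], each function is its constant plus [n ln (P / n)] up to an error of order
    [1 / P]; the growing terms cancel. *)
Lemma cvg_log_power_diff (f g : R -> R) (a b c d n : R) :
  0 <= c -> 0 <= d -> 0 < n ->
  (forall P, 0 < P -> a + n * ln (P / n) <= f P <= a + n * ln ((P + c) / n)) ->
  (forall P, 0 < P -> b + n * ln (P / n) <= g P <= b + n * ln ((P + d) / n)) ->
  (f P - g P) @[P --> +oo] --> a - b.
Proof.
move=> c0 d0 n0 fP gP.
have lnB e P : 0 <= e -> 0 < P -> n * ln ((P + e) / n) - n * ln (P / n) <= n * e * P^-1.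
  move=> e0 P0; rewrite -mulrBr -[leRHS]mulrA; apply: ler_wpM2l; first exact: ltW.
  have Pe : 0 < P + e by rewrite ltr_wpDr.
  rewrite -ln_div ?posrE ?divr_gt0//.
  rewrite (_ : (P + e) / n / (P / n) = 1 + e * P^-1); last first.
    by field; rewrite !gt_eqF.
  apply: le_ln1Dx; rewrite (lt_le_trans (y := 0)) ?ltrN10//.
  by rewrite divr_ge0// ltW.
have invP : (P^-1 : R) @[P --> +oo] --> (0 : R).
  by apply/gtr0_cvgV0; [near=> P; near: P; exact: nbhs_pinfty_gt|exact: cvg_id].
apply: (squeeze_cvgr (f := fun P => a - b - n * d * P^-1)
    (h := fun P => a - b + n * c * P^-1)).
- near=> P; have P0 : 0 < P by near: P; exact: nbhs_pinfty_gt.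
  have /andP[f1 f2] := fP _ P0; have /andP[g1 g2] := gP _ P0.
  have h1 := lnB _ _ c0 P0; have h2 := lnB _ _ d0 P0.
  by apply/andP; split; lra.
- rewrite -[X in _ --> X]subr0; apply: cvgB; first exact: cvg_cst.
  by rewrite -[X in _ --> X](mulr0 (n * d)); apply: cvgMr.
- rewrite -[X in _ --> X]addr0; apply: cvgD; first exact: cvg_cst.
  by rewrite -[X in _ --> X](mulr0 (n * c)); apply: cvgMr.
Unshelve. all: by end_near. Qed.

Lemma Re_le (x y : C) : x <= y -> Re x <= Re y.
Proof. by rewrite lecE => /andP[]. Qed.

Lemma ReK (x : C) : 0 <= x -> (Re x)%:C%C = x.
Proof. by move=> x0; rewrite RRe_real// ger0_real. Qed.

Lemma tr_psd_ge0 n (Q : 'M[C]_n) : psd Q -> 0 <= \tr Q.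
Proof.
move=> /psd_spectral[U [d [UU UU' d0 ->]]].
by rewrite mxtrace_mulC mulmxA UU mul1mx mxtrace_diag sumr_ge0.
Qed.

Lemma det_1Dpsd_ge1 n (Q : 'M[C]_n) : psd Q -> 1 <= \det (1%:M + Q).
Proof.
move=> /psd_spectral[U [d [UU UU' d0 ->]]].
have -> : 1%:M + hadj U *m diag_mx d *m U =
    hadj U *m diag_mx (const_mx 1 + d) *m U.
  by rewrite linearD/= mulmxDr mulmxDl diag_const_mx mulmx1 UU'.
rewrite det_spectral// det_diag.
have : \prod_(i < n) (1 : C) <= \prod_i (const_mx 1 + d) 0 i.
  by apply: ler_prod => i _; rewrite ler01/= !mxE lerDl.
by rewrite big1_eq.
Qed.

(* The trace loses at most [tr Q] because [G^H (G G^H)^-1 G] is a projection. *)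
Lemma det_1Dgram_le n L (G : 'M[C]_(n, L)) (Q : 'M[C]_L) :
  G *m hadj G \in unitmx -> psd Q ->
  \det (1%:M + G *m Q *m hadj G) <= \det (G *m hadj G) *
    ((\tr (invmx (G *m hadj G)) + \tr Q) / n%:R) ^+ n.
Proof.
move=> uW pQ; set W := G *m hadj G in uW *.
have pW : psd W by exact: psd_gram.
have pX : psd (1%:M + G *m Q *m hadj G).
  by apply: psdD; [exact: psd1|exact: psd_conj].
have -> : 1%:M + G *m Q *m hadj G =
    W *m (invmx W *m (1%:M + G *m Q *m hadj G)) by rewrite mulKVmx.
rewrite det_mulmx ler_wpM2l ?det_psd_ge0//.
have /andP[_ h] := det_invmx_mul_psd pW uW pX; apply: le_trans h _.
have t0 : 0 <= \tr (invmx W *m (1%:M + G *m Q *m hadj G)).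
  have [T ->] := psd_invmx_factor pW uW.
  by rewrite -(mulmxA _ T) mxtrace_mulC; apply: tr_psd_ge0; exact: psd_conj.
apply: lerXn2r.
- by apply: divr_ge0; [exact: t0|exact: ler0n].
- apply: divr_ge0; last exact: ler0n.
  by apply: addr_ge0; apply: tr_psd_ge0; [exact: psd_invmx|exact: pQ].
rewrite ler_wpM2r ?invr_ge0 ?ler0n// mulmxDr mulmx1 mxtraceD lerD2l.
rewrite !mulmxA mxtrace_mulC !mulmxA -subr_ge0 -raddfB/=.
have -> : Q - hadj G *m invmx W *m G *m Q = nullproj G *m Q.
  by rewrite /nullproj mulmxBl mul1mx.
have nG : nullproj G *m nullproj G = nullproj G by exact: nullproj_idem.
rewrite -nG -(mulmxA (nullproj G)) mxtrace_mulC -{2}hadj_nullproj.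
by apply: tr_psd_ge0; exact: psd_conj.
Qed.

End HighSNR.

(** * Bounds on the DPC sum capacity *)

Section DPC.
Context (R : realType).
Local Notation C := R[i].
Local Notation Re := (@complex.Re R).

Lemma sup_between (E : set R) (lo hi : R) :
  (exists2 x, E x & lo <= x) -> (forall x, E x -> x <= hi) -> lo <= sup E <= hi.
Proof.
move=> [x Ex lox] Ehi; have ub : ubound E hi by [].
have hE : has_sup E by split; [exists x|exists hi].
apply/andP; split; first by apply: (le_trans lox); exact: sup_upper_bound.
by apply: ge_sup => //; exists x.
Qed.

(** The left side is [det W * det (W^-1 + Q)] with [W = H H^H], and AM-GM bounds the second
    factor. *)
Lemma det_1Dgram_dual_le n M (H : 'M[C]_(n, M)) (Q : 'M[C]_n) :
  H *m hadj H \in unitmx -> psd Q ->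
  \det (1%:M + hadj H *m Q *m H) <= \det (H *m hadj H) *
    ((\tr (invmx (H *m hadj H)) + \tr Q) / n%:R) ^+ n.
Proof.
move=> uW pQ; set W := H *m hadj H in uW *.
have pW : psd W by exact: psd_gram.
rewrite -mulmxA det_1mul_comm -mulmxA -/W.
have -> : 1%:M + Q *m W = (invmx W + Q) *m W by rewrite mulmxDl mulVmx.
rewrite det_mulmx mulrC ler_wpM2l ?det_psd_ge0// -mxtraceD.
by apply: det_psd_le; apply: psdD; [exact: psd_invmx|exact: pQ].
Qed.

Lemma det_gram_trace_real n (W Q : 'M[C]_n) (m : nat) (T : 'M[C]_m) :
  psd W -> psd Q -> psd T ->
  \det W * ((\tr Q + \tr T) / n%:R) ^+ n =
  (Re (\det W) * ((Re (\tr Q) + Re (\tr T)) / n%:R) ^+ n)%:C%C.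
Proof.
move=> pW pQ pT; rewrite rmorphM rmorphXn rmorphM fmorphV rmorph_nat rmorphD/=.
by rewrite !ReK ?det_psd_ge0 ?tr_psd_ge0.
Qed.

Lemma ln2_gt0 : 0 < ln (2 : R).
Proof. by rewrite ln_gt0// ltr1n. Qed.

Section Stacking.
Variables (K N M : nat) (H : 'M[C]_(K * N, M)).

Definition block_sel (k : 'I_K) : 'M[C]_(N, K * N) :=
  \matrix_(i, j) (j == blk_idx k i)%:R.

Lemma HblkE k : Hblk H k = block_sel k *m H.
Proof.
apply/matrixP => i j; rewrite !mxE (bigD1 (blk_idx k i))//= big1 => [|r rk].
  by rewrite mxE eqxx mul1r addr0.
by rewrite mxE (negbTE rk) mul0r.
Qed.

Lemma blk_idx_inj (k k' : 'I_K) (i i' : 'I_N) :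
  blk_idx k i = blk_idx k' i' -> k = k' /\ i = i'.
Proof.
move=> /(congr1 val)/= E; have N0 : (0 < N)%N by apply: leq_trans (ltn_ord i).
have Ek : ((k * N + i) %/ N = (k' * N + i') %/ N)%N by rewrite E.
move: Ek; rewrite !divnMDl// !divn_small// !addn0 => /val_inj kk.
by split=> //; apply/val_inj; move: E; rewrite kk => /addnI.
Qed.

Lemma blk_idx_surj (j : 'I_(K * N)) : exists k i, j = @blk_idx K N k i.
Proof.
have N0 : (0 < N)%N by case: N j => [[j]|]//; rewrite muln0.
have kK : ((j %/ N)%N < K)%N by rewrite ltn_divLR.
exists (Ordinal kK), (Ordinal (ltn_pmod j N0)).
by apply/val_inj; rewrite /= -divn_eq.
Qed.

Lemma block_sel_adj k : block_sel k *m hadj (block_sel k) = 1%:M.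
Proof.
apply/matrixP => i i'; rewrite mxE (bigD1 (blk_idx k i))//= big1 => [|r rk].
  rewrite hadjE !mxE eqxx mul1r addr0 conjC_nat; congr (nat_of_bool _)%:R.
  by apply/eqP/eqP; [move=> /blk_idx_inj[]|move=> ->].
by rewrite mxE (negbTE rk) mul0r.
Qed.

Lemma sum_block_sel : \sum_k hadj (block_sel k) *m block_sel k = 1%:M.
Proof.
apply/matrixP => j j'; rewrite summxE mxE.
have [k [i ->]] := blk_idx_surj j.
rewrite (bigD1 k)//= big1 => [|k' kk].
  rewrite mxE (bigD1 i)//= big1 => [|i' ii].
    by rewrite hadjE !mxE eqxx conjC1 mul1r !addr0 eq_sym.
  rewrite hadjE !mxE; case: eqP => [/blk_idx_inj[_ E]|]; last by rewrite conjC0 mul0r.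
  by rewrite E eqxx in ii.
rewrite mxE big1// => i' _; rewrite hadjE !mxE.
case: eqP => [/blk_idx_inj[E _]|]; last by rewrite conjC0 mul0r.
by rewrite E eqxx in kk.
Qed.

(** The users' covariances are assembled into one block diagonal matrix, which reduces the sum to a
    single-user expression. *)
Lemma sum_Hblk (Q : 'I_K -> 'M[C]_N) :
  \sum_(k < K) hadj (Hblk H k) *m Q k *m Hblk H k =
  hadj H *m (\sum_(k < K) hadj (block_sel k) *m Q k *m block_sel k) *m H.
Proof.
rewrite mulmx_sumr mulmx_suml; apply: eq_bigr => k _.
by rewrite HblkE hadjM !mulmxA.
Qed.

Lemma C_DPC_bounds (P : R) : (0 < K)%N -> (0 < N)%N ->
  H *m hadj H \in unitmx -> 0 < P ->
  ln (Re (\det (H *m hadj H))) + (K * N)%:R * ln (P / (K * N)%:R) <=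
  ln 2 * C_DPC H P <=
  ln (Re (\det (H *m hadj H))) + (K * N)%:R *
    ln ((P + Re (\tr (invmx (H *m hadj H)))) / (K * N)%:R).
Proof.
move=> K0 N0 uW P0; set W := H *m hadj H in uW *.
have pW : psd W by exact: psd_gram.
have pWi := psd_invmx pW uW.
have n0 : 0 < (K * N)%:R :> R by rewrite ltr0n muln_gt0 K0.
have dW : 0 < Re (\det W).
  by have := psd_unit_det_gt0 pW uW; rewrite ltcE => /andP[].
have c0 : 0 <= Re (\tr (invmx W)).
  by have := tr_psd_ge0 pWi; rewrite lecE => /andP[].
have lnX r : 0 < r -> ln (Re (\det W) * r ^+ (K * N)) =
    ln (Re (\det W)) + (K * N)%:R * ln r.
  by move=> r0; rewrite lnM ?posrE ?exprn_gt0// lnXn// mulr_natl.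
have l2 := ln2_gt0.
suff /andP[h1 h2] : (ln (Re (\det W)) + (K * N)%:R * ln (P / (K * N)%:R)) / ln 2 <=
    C_DPC H P <= (ln (Re (\det W)) + (K * N)%:R *
      ln ((P + Re (\tr (invmx W))) / (K * N)%:R)) / ln 2.
  by rewrite ![ln 2 * _]mulrC -ler_pdivrMr// h1 -ler_pdivlMr.
apply: sup_between.
  (* Equal power on all [K N] receive dimensions, which spends exactly [P]. *)
  pose p := P / (K * N)%:R; have p0 : 0 < p by rewrite divr_gt0.
  exists (log2det (1%:M + \sum_(k < K) hadj (Hblk H k) *m (p%:C%C)%:M *m Hblk H k)).
    exists (fun=> (p%:C%C)%:M); split=> //; split.
      by move=> k; apply: psd_scalar; rewrite ler0c ltW.
    under eq_bigr do rewrite mxtrace_scalar raddfMn/=.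
    rewrite sumr_const card_ord -!mulrnA mulnC -mulr_natr.
    by rewrite /p mulfVK// gt_eqF.
  rewrite /log2det /log2 ler_wpM2r ?invr_ge0 ?(ltW ln2_gt0)//.
  rewrite -lnX//.
  have h : Re (\det W) * p ^+ (K * N) <= Re (\det (1%:M +
      \sum_(k < K) hadj (Hblk H k) *m (p%:C%C)%:M *m Hblk H k)).
    rewrite sum_Hblk.
    have -> : \sum_(k < K) hadj (block_sel k) *m (p%:C%C)%:M *m block_sel k =
        (p%:C%C)%:M.
      under eq_bigr do rewrite mul_mx_scalar -scalemxAl.
      by rewrite -scaler_sumr sum_block_sel scalemx1.
    rewrite mul_mx_scalar det_1mul_comm -scalemxAr -/W.
    have := @det_1Dscale_ge R _ W (p%:C%C) _ pW; rewrite ler0c => /(_ (ltW p0)).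
    by move=> /Re_le; rewrite -rmorphXn ReCM mulrC.
  rewrite ler_ln ?posrE//; first by rewrite mulr_gt0 ?exprn_gt0.
  by apply: lt_le_trans h; rewrite mulr_gt0 ?exprn_gt0.
move=> _ [Q [[pQ trQ] ->]].
pose Qd := \sum_(k < K) hadj (block_sel k) *m Q k *m block_sel k.
have pQd : psd Qd by apply: psd_sum => k _; exact: psd_conjV.
have trQd : Re (\tr Qd) <= P.
  suff -> : \tr Qd = \sum_(k < K) \tr (Q k) by rewrite Re_sum.
  rewrite /Qd (raddf_sum (@mxtrace C (K * N))); apply: eq_bigr => k _ /=.
  by rewrite -mulmxA mxtrace_mulC -mulmxA block_sel_adj mulmx1.
have q0 : 0 <= Re (\tr Qd) by have := tr_psd_ge0 pQd; rewrite lecE => /andP[].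
rewrite sum_Hblk -/Qd /log2det /log2 ler_wpM2r ?invr_ge0 ?(ltW ln2_gt0)//.
have d1 : 1 <= Re (\det (1%:M + hadj H *m Qd *m H)).
  by have /Re_le := det_1Dpsd_ge1 (psd_conjV H pQd).
have Pc : 0 < (P + Re (\tr (invmx W))) / (K * N)%:R.
  by rewrite divr_gt0// ltr_wpDr.
rewrite -lnX// ler_ln ?posrE ?(lt_le_trans ltr01 d1)//; last first.
  by rewrite mulr_gt0 ?exprn_gt0.
have /Re_le := det_1Dgram_dual_le uW pQd.
rewrite -/W det_gram_trace_real//= => h; apply: le_trans h _.
apply: ler_wpM2l; first exact: ltW.
apply: lerXn2r; rewrite ?nnegrE ?(ltW Pc)//.
  by rewrite divr_ge0// addr_ge0.
by rewrite ler_wpM2r ?invr_ge0 ?(ltW n0)// addrC lerD2r.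
Qed.

End Stacking.
End DPC.

(** * Bounds on the block diagonalization sum rate *)

Section BlockDiagonalization.
Context (R : realType).
Local Notation C := R[i].
Local Notation Re := (@complex.Re R).

Lemma ln_prod (I : Type) (r : seq I) (x : I -> R) : (forall i, 0 < x i) ->
  ln (\prod_(i <- r) x i) = \sum_(i <- r) ln (x i).
Proof.
move=> x0; elim: r => [|i r IH]; first by rewrite !big_nil ln1.
by rewrite !big_cons lnM ?IH// posrE// prodr_gt0.
Qed.

(** Gram-Schmidt acts on rows, so a row basis of the left kernel of [hadj A] is orthonormalized and
    its adjoint taken. *)
Lemma exists_orthonormal_kernel (m M : nat) (A : 'M[C]_(m, M)) :
  A *m hadj A \in unitmx -> exists V : 'M[C]_(M, M - m),
  [/\ hadj V *m V = 1%:M, A *m V = 0 &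
      forall x : 'cV[C]_M, A *m x = 0 -> exists y, x = V *m y].
Proof.
move=> uA.
have rA : \rank A = m.
  apply/eqP; rewrite eqn_leq rank_leq_row/=.
  by rewrite -[X in (X <= _)%N](mxrank_unit uA) mxrankM_maxl.
have rH : \rank (hadj A) = m by rewrite /hadj mxrank_tr mxrank_map.
have [T [fT TE]] : exists T : 'M[C]_(M - m, M), row_free T /\ (T :=: kermx (hadj A))%MS.
  have rk : \rank (kermx (hadj A)) = (M - m)%N by rewrite mxrank_ker rH.
  rewrite -rk; exists (row_base (kermx (hadj A))).
  by split; [exact: row_base_free|exact: eq_row_base].
set U := schmidt T.
have UE : (U :=: kermx (hadj A))%MS.
  exact: eqmx_trans (eqmx_schmidt_free fT) TE.
exists (hadj U); split.
- rewrite hadjK hadj_trmxC; apply/unitarymxP.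
  by apply: schmidt_unitarymx; exact: leq_subr.
- rewrite -[LHS]hadjK hadjM hadjK.
  have /sub_kermxP -> : (U <= kermx (hadj A))%MS by rewrite UE.
  by rewrite hadj0.
- move=> x Ax; have : (hadj x <= U)%MS.
    by rewrite UE; apply/sub_kermxP; rewrite -hadjM Ax hadj0.
  by move=> /submxP[y xy]; exists (hadj y); rewrite -hadjM -xy hadjK.
Qed.

Lemma mulmx_projZ n L (G : 'M[C]_(n, L)) (W : 'M[C]_n) (p : C) :
  G *m hadj G = W -> W \in unitmx ->
  G *m (p *: (hadj G *m invmx W *m G)) *m hadj G = p *: W.
Proof.
move=> GW uW; rewrite -scalemxAr -scalemxAl !mulmxA GW -(mulmxA _ G) GW.
by rewrite mulmxV// mul1mx.
Qed.

Lemma col_matrixP m n (A B : 'M[C]_(m, n)) : (forall i, col i A = col i B) -> A = B.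
Proof. by move=> h; apply/matrixP => i j; have /colP/(_ i) := h j; rewrite !mxE. Qed.

Lemma col_mulmx m n p (A : 'M[C]_(m, n)) (B : 'M[C]_(n, p)) i :
  col i (A *m B) = A *m col i B.
Proof. by rewrite !colE mulmxA. Qed.

Section Bounds.
Variables (K N M : nat) (H : 'M[C]_(K * N, M)) (m : 'I_K -> nat).
Variable (A : forall k : 'I_K, 'M[C]_(m k, M)).
Hypothesis uA : forall k, A k *m hadj (A k) \in unitmx.
Hypothesis AP : forall k (x : 'cV[C]_M),
  (forall j : 'I_K, j != k -> Hblk H j *m x = 0) <-> A k *m x = 0.

Let W k := Hblk H k *m nullproj (A k) *m hadj (Hblk H k).
Hypothesis uW : forall k, W k \in unitmx.

(** [V V^H] is the same projection for every admissible orthonormal basis, so the Gram matrix seen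
    by user [k] does not depend on the precoder. *)
Lemma BD_precoders_proj V k : BD_precoders H V ->
  V k *m hadj (V k) = nullproj (A k).
Proof.
move=> /(_ k)[VV [HV span]].
have AV : A k *m V k = 0.
  apply: col_matrixP => i; rewrite col_mulmx col0.
  by apply/(AP k _) => j jk; rewrite -col_mulmx HV// col0.
have PV : hadj (V k) *m nullproj (A k) = hadj (V k).
  by rewrite -[LHS]hadjK hadjM hadjK hadj_nullproj nullproj_id.
rewrite -[LHS]mulmx1; transitivity (V k *m hadj (V k) *m nullproj (A k)).
  by rewrite mulmx1 -mulmxA PV.
apply: col_matrixP => i; rewrite col_mulmx.
have [|y ->] := span (col i (nullproj (A k))).
  by apply/(AP k _); rewrite -col_mulmx mul_nullproj// col0.
by rewrite -mulmxA (mulmxA (hadj _)) VV mul1mx.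
Qed.

Lemma BD_gram V k : BD_precoders H V ->
  (Hblk H k *m V k) *m hadj (Hblk H k *m V k) = W k.
Proof.
by move=> hV; rewrite hadjM mulmxA -(mulmxA (Hblk H k)) BD_precoders_proj.
Qed.

Let c := \sum_k Re (\tr (invmx (W k))).

Lemma C_BD_bounds (P : R) : (0 < K)%N -> (0 < N)%N ->
  (exists V, BD_precoders H V) -> 0 < P ->
  \sum_k ln (Re (\det (W k))) + (K * N)%:R * ln (P / (K * N)%:R) <=
  ln 2 * C_BD H P <=
  \sum_k ln (Re (\det (W k))) + (K * N)%:R * ln ((P + c) / (K * N)%:R).
Proof.
move=> K0 N0 [V0 hV0] P0.
have n0 : 0 < (K * N)%:R :> R by rewrite ltr0n muln_gt0 K0.
have l2 := ln2_gt0 R.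
have pW k : psd (W k) by apply: psd_conj; exact: psd_nullproj.
have pWi k := psd_invmx (pW k) (uW k).
have dW k : 0 < Re (\det (W k)).
  by have := psd_unit_det_gt0 (pW k) (uW k); rewrite ltcE => /andP[].
have c0 k : 0 <= Re (\tr (invmx (W k))).
  by have := tr_psd_ge0 (pWi k); rewrite lecE => /andP[].
have lnE r : 0 < r -> \sum_k ln (Re (\det (W k))) + (K * N)%:R * ln r =
    ln (\prod_k (Re (\det (W k)) * r ^+ N)).
  move=> r0; rewrite ln_prod; last by move=> k; rewrite mulr_gt0 ?exprn_gt0.
  under [RHS]eq_bigr do rewrite lnM ?posrE ?exprn_gt0// lnXn//.
  rewrite big_split/= sumr_const card_ord -mulrnA; congr (_ + _).
  by rewrite mulr_natl mulnC.
have sumlog (G : 'I_K -> R) : (forall k, 0 < G k) ->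
    \sum_k log2 (G k) = ln (\prod_k G k) / ln 2.
  by move=> G0; rewrite ln_prod// mulr_suml.
suff /andP[h1 h2] : (\sum_k ln (Re (\det (W k))) +
    (K * N)%:R * ln (P / (K * N)%:R)) / ln 2 <= C_BD H P <=
    (\sum_k ln (Re (\det (W k))) + (K * N)%:R * ln ((P + c) / (K * N)%:R)) / ln 2.
  by rewrite ![ln 2 * _]mulrC -ler_pdivrMr// h1 -ler_pdivlMr.
apply: sup_between.
  pose p := P / (K * N)%:R; have p0 : 0 < p by rewrite divr_gt0.
  pose G k := Hblk H k *m V0 k.
  have GW k : G k *m hadj (G k) = W k by exact: BD_gram.
  (* [p] times the projection onto the row space of [G k]: power is spent on [N] dimensions only, so
     the trace is [p N]. *)
  pose Q k := p%:C%C *: (hadj (G k) *m invmx (W k) *m G k).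
  have pQ k : psd (Q k).
    by apply: psdZ; [rewrite ler0c ltW|exact: psd_conjV].
  exists (\sum_k log2det (1%:M + G k *m Q k *m hadj (G k))).
    exists V0, Q; split=> //; split=> //; split=> //.
    have trQ k : \tr (Q k) = (p * N%:R)%:C%C.
      rewrite /Q linearZ/= -mulmxA mxtrace_mulC -mulmxA GW mulVmx// mxtrace1.
      by rewrite -(rmorph_nat (real_complex R)) -rmorphM.
    under eq_bigr do rewrite trQ/=.
    rewrite sumr_const card_ord -[leLHS]mulr_natl mulrCA -natrM.
    by rewrite /p mulfVK// gt_eqF.
  have E k : 1%:M + G k *m Q k *m hadj (G k) = 1%:M + p%:C%C *: W k.
    by congr (_ + _); exact: mulmx_projZ.
  have dge k : Re (\det (W k)) * p ^+ N <= Re (\det (1%:M + p%:C%C *: W k)).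
    have := @det_1Dscale_ge R _ (W k) (p%:C%C) _ (pW k).
    by rewrite ler0c => /(_ (ltW p0)) /Re_le; rewrite -rmorphXn ReCM mulrC.
  have d0 k : 0 < Re (\det (W k)) * p ^+ N by rewrite mulr_gt0 ?exprn_gt0.
  rewrite [leRHS](_ : _ = \sum_k log2 (Re (\det (1%:M + p%:C%C *: W k)))); last first.
    by apply: eq_bigr => k _; rewrite -E.
  rewrite sumlog; last by move=> k; exact: lt_le_trans (dge k).
  rewrite lnE// ler_wpM2r ?invr_ge0 ?(ltW l2)//.
  rewrite ler_ln ?posrE ?prodr_gt0//; last first.
    by move=> k _; exact: lt_le_trans (dge k).
  by apply: ler_prod => k _; rewrite ltW//=.
move=> _ [V [Q [hV [[pQ trQ] ->]]]].
pose G k := Hblk H k *m V k.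
have GW k : G k *m hadj (G k) = W k by exact: BD_gram.
pose d k := Re (\det (1%:M + G k *m Q k *m hadj (G k))).
have d1 k : 1 <= d k.
  by have /Re_le := det_1Dpsd_ge1 (psd_conj (G k) (pQ k)).
have d0 k : 0 < d k := lt_le_trans ltr01 (d1 k).
have q0 k : 0 <= Re (\tr (Q k)) by have := tr_psd_ge0 (pQ k); rewrite lecE => /andP[].
pose r k := (Re (\tr (invmx (W k))) + Re (\tr (Q k))) / N%:R.
have r0 k : 0 <= r k by rewrite divr_ge0// addr_ge0.
have dle k : d k <= Re (\det (W k)) * r k ^+ N.
  have uG : G k *m hadj (G k) \in unitmx by rewrite GW.
  have /Re_le := det_1Dgram_le uG (pQ k).
  by rewrite GW det_gram_trace_real.
have Pc : 0 < (P + c) / (K * N)%:R.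
  by rewrite divr_gt0// ltr_wpDr// sumr_ge0.
rewrite (_ : \sum_k _ = \sum_k log2 (d k))// sumlog// lnE//.
rewrite ler_wpM2r ?invr_ge0 ?(ltW l2)//.
rewrite ler_ln ?posrE ?prodr_gt0//; last first.
  by move=> k _; rewrite mulr_gt0 ?exprn_gt0.
apply: (@le_trans _ _ (\prod_k (Re (\det (W k)) * r k ^+ N))).
  by apply: ler_prod => k _; rewrite dle (ltW (d0 k)).
rewrite !big_split/= ler_wpM2l//; first by rewrite prodr_ge0// => k _; exact: ltW.
rewrite !prodrXl prodr_const card_ord.
apply: lerXn2r; rewrite ?nnegrE ?prodr_ge0 ?exprn_ge0 ?(ltW Pc)//.
(* A second AM-GM, across users, replaces the individual power splits by the total power. *)
have [+ _] := @leif_AGM R 'I_K xpredT r (fun k _ => r0 k).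
rewrite (eq_card (_ : _ =i 'I_K))// card_ord.
have -> : \prod_(k in xpredT) r k = \prod_k r k by apply: eq_bigl.
have -> : \sum_(k in xpredT) r k = \sum_k r k by apply: eq_bigl.
move=> h; apply: le_trans h _; apply: lerXn2r.
- by rewrite nnegrE divr_ge0// sumr_ge0.
- by rewrite nnegrE ltW.
rewrite /r -mulr_suml big_split/= -/c natrM invfM mulrA mulrAC.
rewrite ler_wpM2r ?invr_ge0// ler_wpM2r ?invr_ge0//.
by rewrite addrC lerD2r.
Qed.

End Bounds.
End BlockDiagonalization.

(** * The high-SNR gap as a log gain *)

Section HighSNRGap.
Context (R : realType) (K N M : nat).
Hypotheses (K0 : (0 < K)%N) (N0 : (0 < N)%N).
Local Notation C := R[i].
Local Notation Re := (@complex.Re R).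
Variables (H : 'M[C]_(K * N, M)) (l : seq 'rV[C]_M).
Hypothesis sl : size l = (K * N)%N.
Hypothesis lE : forall i : 'I_(K * N), nth 0 l i = row i H.
Hypothesis gl : generic_rows N l.

Let others (k : 'I_K) := other_rows N k l.
Let A (k : 'I_K) := rows_mx (size (others k)) (others k).

Let rows_mxE : rows_mx (K * N) l = H.
Proof. by apply/row_matrixP => i; rewrite rowK lE. Qed.

Lemma rows_mx_mul_eq0 (s : seq 'rV[C]_M) (x : 'cV[C]_M) :
  rows_mx (size s) s *m x = 0 <-> {in s, forall a, a *m x = 0}.
Proof.
split=> [h a /(nthP 0)[i si <-]|h].
  have := congr1 (row (Ordinal si)) h.
  by rewrite row_mul rowK row0.
apply/row_matrixP => i; rewrite row_mul rowK row0; apply: h.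
by rewrite mem_nth.
Qed.

Lemma other_rows_kernel (k : 'I_K) (x : 'cV[C]_M) :
  (forall j : 'I_K, j != k -> Hblk H j *m x = 0) <-> A k *m x = 0.
Proof.
have divE (j : 'I_K) (i : 'I_N) : (blk_idx j i %/ N)%N = j.
  by rewrite /= divnMDl// divn_small// addn0.
have rowE (j : 'I_K) (i : 'I_N) : nth 0 l (blk_idx j i) = row i (Hblk H j).
  by rewrite lE; apply/rowP => c; rewrite !mxE.
split=> [h|/rows_mx_mul_eq0 h j jk].
  apply/rows_mx_mul_eq0.
  suff /allP al : all (fun a => a *m x == 0) (others k) by move=> a /al/eqP.
  rewrite all_map; apply/allP => r.
  rewrite mem_filter mem_iota add0n sl /= => /andP[rk rKN].
  have [j [i E]] := blk_idx_surj (Ordinal rKN).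
  have rE : r = blk_idx j i by rewrite -E.
  rewrite rE rowE -row_mul h ?row0//.
  by move: rk; rewrite rE divE.
apply/row_matrixP => i; rewrite row_mul row0 -rowE; apply: h.
apply: (map_f (fun r => nth 0 l r)).
by rewrite mem_filter divE jk mem_iota sl ltn_ord.
Qed.

Lemma perm_other_rows (k : 'I_K) :
  perm_eq l (others k ++ [seq nth 0 l i | i <- iota (k * N) N]).
Proof.
rewrite /others /other_rows -map_cat.
have {1}<- : [seq nth 0 l i | i <- iota 0 (size l)] = l by exact: mkseq_nth.
apply: perm_map; rewrite perm_sym.
apply: perm_trans (permEl (perm_filterC (fun i => (i %/ N)%N != k) _)).
rewrite perm_cat2l; apply: uniq_perm; rewrite ?iota_uniq ?filter_uniq ?iota_uniq//.
move=> i; rewrite mem_filter !mem_iota add0n sl /= negbK.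
apply/idP/idP => [/andP[ki ik]|/andP[/eqP <- _]].
  have iN : (i < k.+1 * N)%N by rewrite mulSn addnC.
  rewrite eqn_leq -ltnS ltn_divLR// leq_divRL// ki iN/=.
  by apply: leq_trans iN _; rewrite leq_mul2r ltn_ord orbT.
by rewrite leq_trunc_div {1}(divn_eq i N) ltn_add2l ltn_mod.
Qed.

Let W (k : 'I_K) := Hblk H k *m nullproj (A k) *m hadj (Hblk H k).

(** With block [k] moved to the end of the list, [W k] is the Schur complement of the remaining
    rows. *)
Lemma gram_block (k : 'I_K) : gram l = gram (others k) * \det (W k).
Proof.
have s2 : size [seq nth 0 l i | i <- iota (k * N) N] = N.
  by rewrite size_map size_iota.
rewrite (gram_perm (perm_other_rows k)) (gram_cat s2); last exact: gl.2.
suff -> : rows_mx N [seq nth 0 l i | i <- iota (k * N) N] = Hblk H k by [].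
apply/matrixP => i j; rewrite !mxE (nth_map 0%N) ?size_iota// nth_iota//.
by rewrite (lE (blk_idx k i)) mxE.
Qed.

Lemma det_block_gt0 k : 0 < \det (W k).
Proof.
have := gl.1; rewrite (gram_block k).
by rewrite pmulr_rgt0//; exact: gl.2.
Qed.

(** Without a precoder the supremum in [C_BD] would range over the empty set and carry no
    information. *)
Lemma exists_BD_precoders : exists V, BD_precoders H V.
Proof.
have ex (k : 'I_K) : exists Vk : 'M[C]_(M, M - (K - 1) * N),
    [/\ hadj Vk *m Vk = 1%:M, A k *m Vk = 0 &
        forall x : 'cV[C]_M, A k *m x = 0 -> exists y, x = Vk *m y].
  have <- : size (others k) = ((K - 1) * N)%N.
    rewrite size_other_rows//; first by rewrite sl mulnBl mul1n.
    by rewrite sl leq_mul2r ltn_ord orbT.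
  by apply: exists_orthonormal_kernel; apply: gram_unit; exact: gl.2.
have [V hV] := choice ex; exists V => k; have [V1 V2 V3] := hV k; split=> //.
split=> [j jk|x hx]; last by apply: V3; exact/other_rows_kernel.
apply: col_matrixP => i; rewrite col_mulmx col0; move: j jk.
by apply/(other_rows_kernel k); rewrite -col_mulmx V2 col0.
Qed.

(** The limit is [ln g] minus the sum over [k] of [ln g - ln g_k], where [g] and [g_k] are the Gram
    determinants of all rows and of those outside block [k]. *)
Lemma beta_DPC_BD_log_gain :
  beta_DPC_BD H = (ln (2 : R))^-1 * log_gain K N l.
Proof.
have gW : gram l = \det (H *m hadj H) by rewrite (gramE sl) rows_mxE.
have uH : H *m hadj H \in unitmx.
  by rewrite unitmxE unitfE -gW gt_eqF// gl.1.
have uA k : A k *m hadj (A k) \in unitmx by apply: gram_unit; exact: gl.2.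
have uW k : W k \in unitmx by rewrite unitmxE unitfE gt_eqF// det_block_gt0.
have tr0 n (X : 'M[C]_n) : psd X -> X \in unitmx -> 0 <= Re (\tr (invmx X)).
  by move=> pX uX; have := tr_psd_ge0 (psd_invmx pX uX); rewrite lecE => /andP[].
have pW k : psd (W k) by apply: psd_conj; exact: psd_nullproj.
have n0 : 0 < (K * N)%:R :> R by rewrite ltr0n muln_gt0 K0.
have cv := cvg_log_power_diff (tr0 _ _ (psd_gram H) uH)
  (sumr_ge0 (index_enum 'I_K) (fun k _ => tr0 _ _ (pW k) (uW k))) n0
  (fun P => C_DPC_bounds K0 N0 uH)
  (fun P => C_BD_bounds uA other_rows_kernel uW K0 N0 exists_BD_precoders).
have l2 : ln (2 : R) != 0 by rewrite gt_eqF// ln2_gt0.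
rewrite /beta_DPC_BD; apply: cvg_lim => //.
rewrite (_ : (fun P => _) = (fun P => (ln 2)^-1 *
    (ln 2 * C_DPC H P - ln 2 * C_BD H P))); last first.
  by apply/funext => P; rewrite -mulrBr mulKf.
apply: cvgMr; move: cv; congr (_ --> _).
rewrite /log_gain -gW.
have -> : \sum_k ln (Re (\det (W k))) =
    \sum_k (ln (Re (gram l)) - ln (Re (gram (others k)))).
  apply: eq_bigr => k _; rewrite (gram_block k) ln_ReM ?det_block_gt0//.
    by rewrite addrAC subrr add0r.
  exact: gl.2.
rewrite sumrB sumr_const card_ord -[K in _ *+ K](prednK K0) mulrS -mulr_natl.
by ring.
Qed.

End HighSNRGap.

Lemma nth_rows_of_seq (R : realType) (p M : nat) (s : seq R) (i : 'I_p) :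
  nth 0 (rows_of_seq M p s) i = row i (cmx_of_seq p M s).
Proof.
rewrite (nth_map 0%N) ?size_iota// nth_iota// add0n.
apply/rowP => j; rewrite !mxE !nth_drop.
by congr (Complex (nth 0 s _) (nth 0 s _)); lia.
Qed.

Theorem theorem4 (R : realType) (K N M : nat) :
  (1 <= K)%N -> (1 <= N)%N -> (K * N <= M)%N ->
  beta_bar R K N M =
  ((ln (2 : R))^-1 *
     \sum_(k < K) \sum_(n < N) \sum_(k * N + 1 <= i < (K - 1) * N + 1)
        ((M - n - i)%:R)^-1)%:E.
Proof.
move=> K0 N0 KM; rewrite /beta_bar -sum_harmonic_blocks//.
rewrite (_ : 2 * (K * N * M) = 2 * M * (K * N))%N; last first.
  by rewrite -[RHS]mulnA [(M * _)%N]mulnC.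
apply: gauss_mean_expect.
(* The gap equals the scaled log gain at generic channels only; these are almost all. *)
apply: gauss_mean_ae (gauss_meanZ _ (gauss_mean_log_gain R N0 (leqnn _) KM)).
apply: gauss_ae_impl (gauss_ae_generic_rows R N KM) => s _ gs.
rewrite (beta_DPC_BD_log_gain K0 N0 _ _ gs)//.
- by rewrite size_rows_of_seq.
- by move=> i; rewrite nth_rows_of_seq.
Qed.
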